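(* Let $f:\mathbb{C}\to\mathbb{C}$ be given by $f(z)=2z+2-\log 2-e^{z}$. Then the set $$I(f,(\sqrt{2}^{\,n}))=\{z\in\mathbb{C}: |f^n(z)|\geq \sqrt{2}^{\,n}\ \text{ for all } n\in\mathbb{N}\}$$ contains a spider's web, and hence the escaping set $I(f)=\{z\in\mathbb{C}: f^n(z)\to\infty\text{ as }n\to\infty\}$ is a spider's web.
   Context: $f^n$ denotes the $n$th iterate of $f$, and $\mathbb{N}=\{1,2,\dots\}$. A set $E\subset\mathbb{C}$ is an (infinite) spider's web if $E$ is connected and there exists a sequence $(G_n)_{n\in\mathbb{N}}$ of bounded simply connected domains with $G_n\subset G_{n+1}$ and $\partial G_n\subset E$ for all $n\in\mathbb{N}$, and $\bigcup_{n\in\mathbb{N}}G_n=\mathbb{C}$. ''A set contains a spider's web'' means that it has a subset which is a spider's web. *)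

(* Defs.v *)
From HB Require Import structures.
From mathcomp Require Import all_boot all_order all_algebra complex.
From mathcomp Require Import all_classical all_reals all_analysis.

Set Implicit Arguments.
Unset Strict Implicit.
Unset Printing Implicit Defensive.

Import Order.TTheory GRing.Theory Num.Theory.
Import numFieldNormedType.Exports.
Import ComplexField.Normc.

Local Open Scope classical_set_scope.
Local Open Scope complex_scope.
Local Open Scope ring_scope.

(* The complex plane is R[i] for R : realType; MathComp-Analysis puts the
   topology of the modulus on the alias R[i]^o.  The modulus `|z| is an element
   of R[i], equal to (normc z)%:C; normc z is the same modulus as an element of
   R. *)

Section SpidersWeb.
Variable R : realType.
Implicit Types E G : set R[i]^o.

Definition boundary E : set R[i]^o := closure E `\` interior E.

Definition domain G := [/\ open G, connected G & G !=set0].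

(* Null-homotopy through closed curves: the base point may move with s. *)
Definition null_homotopic_in G (gamma : R -> R[i]^o) :=
  exists (H : R * R -> R[i]^o) (c : R[i]),
    [/\ {within `[0, 1] `*` `[0, 1], continuous H},
        forall s t : R, s \in `[0, 1] -> t \in `[0, 1] -> G (H (s, t)),
        forall t : R, t \in `[0, 1] -> H (0, t) = gamma t,
        forall t : R, t \in `[0, 1] -> H (1, t) = c
      & forall s : R, s \in `[0, 1] -> H (s, 0) = H (s, 1)].

Definition simply_connected_domain G :=
  domain G /\
  forall gamma : R -> R[i]^o,
    {within `[0, 1], continuous gamma} ->
    (forall t : R, t \in `[0, 1] -> G (gamma t)) ->
    gamma 0 = gamma 1 ->
    null_homotopic_in G gamma.

Definition spiders_web E :=
  connected E /\
  exists G : nat -> set R[i]^o,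
    [/\ forall n, bounded_set (G n),
        forall n, simply_connected_domain (G n),
        forall n, G n `<=` G n.+1,
        forall n, boundary (G n) `<=` E
      & \bigcup_n G n = setT].

Definition contains_spiders_web (A : set R[i]^o) := exists2 E, E `<=` A & spiders_web E.

End SpidersWeb.

Section Dynamics.
Variable R : realType.

(* e^(x + iy) = e^x (cos y + i sin y) *)
Definition cexp (z : R[i]) : R[i] :=
  (expR (complex.Re z))%:C * (cos (complex.Im z) +i* sin (complex.Im z)).

(* The modulus is bounded below from the first iterate on, not at n = 0. *)
Definition I_seq (f : R[i] -> R[i]) (a : nat -> R) : set R[i]^o :=
  [set z | forall n, (0 < n)%N -> a n <= normc (iter n f z)].

Definition escaping_set (f : R[i] -> R[i]) : set R[i]^o :=
  [set z | (fun n => normc (iter n f z)) @ \oo --> +oo].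

Definition dyn_map (z : R[i]) : R[i] := 2 * z + 2 - (ln 2)%:C - cexp z.

End Dynamics.

(* Main.v *)
(* In real coordinates [Re f = 2x + 2 - ln 2 - e^x cos y] and
   [Im f = 2y - e^x sin y], so [f] preserves the family of lines
   [Im z = 2 pi k], doubling their height, and pushes the left half plane
   further to the left; both escape at the rate [sqrt 2 ^ n].  On each closed
   strip between two consecutive lines [f] is onto the plane, and injective
   away from the lines.

   Let [s_n] be a rapidly increasing sequence of multiples of [2 pi] and let
   [square n], [rect n] be the boxes [|x|, |y| < s_n] and
   [- s_n < x < 2 s_n, |y| < s_n], so that [f] maps [square n] into
   [square (n+1)].  The domain [G_n] consists of the points whose orbit stays
   in [rect n, rect (n+1), ...] until it enters one of the squares.  A boundary
   point of [G_n] either stays far to the right forever, or reaches the left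
   side of a rectangle (left half plane) or a horizontal side (a line of the
   family), so it grows at least like [sqrt 2 ^ n].

   [G_n] is the increasing union over [j] of the sets [inner j n] of points
   entering the square after at most [j] steps.  Each of them is contractible:
   a leftward deformation of [inner j (n+1)] moves points only in [x >= s - 1],
   away from the lines, hence lifts through the inverse branches of [f] on the
   strips.  The boundary of [G_n], without its left side, is the decreasing
   intersection over [j] of compact sets [rim j n].  These are connected by
   induction on [j]: the part of [rim (j+1) n] in a strip is mapped bijectively
   by [f] onto [rim j (n+1)] together with the two pieces of its left side
   outside the image of the strip, and consecutive parts share a point.

   Finally, suppose that the escaping set were covered by two disjoint open
   sets, both meeting it.  A component [V] of the one not containing the web,
   cut down to some [G_m], is bounded and has no escaping point in its
   boundary; as the web is connected and unbounded, no image [f^n V] meets it.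
   Hence [f^n V] stays in one complementary component of the web, outside any
   [G_k] for large [n], so that the boundary points of [V] escape, a
   contradiction. *)
Require Import Defs.
From mathcomp Require Import all_boot all_order all_algebra complex.
From mathcomp Require Import ring lra zify.
From mathcomp Require Import all_classical all_reals all_analysis.
Set Implicit Arguments.
Unset Strict Implicit.
Unset Printing Implicit Defensive.
Import Order.TTheory GRing.Theory Num.Theory.
Import numFieldNormedType.Exports.
Import ComplexField.Normc.
Local Open Scope classical_set_scope.
Local Open Scope complex_scope.
Local Open Scope ring_scope.

(** * Topology of the plane *)

Section Topology.
Variable R : realType.
Local Notation C := (R[i]^o).
Local Notation Re := complex.Re.
Local Notation Im := complex.Im.

Lemma normc_ge_absRe (z : R[i]) : `|Re z| <= normc z.
Proof.
by case: z => x y; rewrite /= -sqrtr_sqr ler_wsqrtr // lerDl sqr_ge0.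
Qed.

Lemma normc_ge_absIm (z : R[i]) : `|Im z| <= normc z.
Proof.
by case: z => x y; rewrite /= -sqrtr_sqr ler_wsqrtr // lerDr sqr_ge0.
Qed.

Lemma normc_le_absD (z : R[i]) : normc z <= `|Re z| + `|Im z|.
Proof.
case: z => x y /=; rewrite -[leRHS]ger0_norm ?addr_ge0 // -sqrtr_sqr.
apply: ler_wsqrtr; rewrite sqrrD !real_normK ?num_real //.
by rewrite lerD2r lerDl mulrn_wge0 // mulr_ge0.
Qed.

Lemma normCE (z : R[i]) : `|z : C| = (normc z)%:C.
Proof. by []. Qed.

Lemma nbhs_boxP (z : C) (A : set C) :
  nbhs z A <-> exists2 e : R, 0 < e &
    forall w : C, `|Re w - Re z| < e -> `|Im w - Im z| < e -> A w.
Proof.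
split.
- case/nbhs_ballP => e /= e0 eA.
  move: e0; case: e eA => e e' eA.
  rewrite ltcE /= => /andP[/eqP ee e0]; subst e'.
  exists (e / 2); first by rewrite divr_gt0.
  move=> w w1 w2; apply: eA; rewrite /ball /= normCE ltcR.
  apply: le_lt_trans (normc_le_absD _) _.
  case: z w w1 w2 => [x y] [x' y'] /=; rewrite distrC => h1; rewrite distrC => h2; lra.
- case=> e e0 eA; apply/nbhs_ballP; exists (e%:C); first by rewrite /= ltcR.
  move=> w; rewrite /ball /= normCE ltcR => we.
  have h1 := le_lt_trans (normc_ge_absRe _) we.
  have h2 := le_lt_trans (normc_ge_absIm _) we.
  by case: z w h1 h2 eA {we} => [x y] [x' y'] /= h1 h2; apply; rewrite distrC.
Qed.

Lemma cvgCP (T : Type) (F : set_system T) {FF : Filter F} (h : T -> C) (l : C) :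
  h @ F --> l <->
  (Re (h x) @[x --> F] --> Re l) /\ (Im (h x) @[x --> F] --> Im l).
Proof.
split.
- move=> hl; split.
  + apply/cvgrPdist_lt => e e0; apply: (hl (fun w => `|Re l - Re w| < e)).
    by apply/nbhs_boxP; exists e => // w; rewrite distrC.
  + apply/cvgrPdist_lt => e e0; apply: (hl (fun w => `|Im l - Im w| < e)).
    by apply/nbhs_boxP; exists e => // w _; rewrite distrC.
- case=> /cvgrPdistC_lt h1 /cvgrPdistC_lt h2 A /nbhs_boxP[e e0 eA].
  by apply: filterS2 (h1 _ e0) (h2 _ e0) => x; exact: eA.
Qed.

Lemma continuous_Re : continuous (@complex.Re R : C -> R).
Proof. by move=> z; have /cvgCP[] : id @ z --> z by exact: cvg_id. Qed.

Lemma continuous_Im : continuous (@complex.Im R : C -> R).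
Proof. by move=> z; have /cvgCP[] : id @ z --> z by exact: cvg_id. Qed.

Definition mkC (p : R * R) : C := p.1 +i* p.2.

Lemma continuous_mkC : continuous mkC.
Proof. by move=> p; apply/cvgCP; split; [exact: cvg_fst|exact: cvg_snd]. Qed.

Definition box (a b c d : R) : set C :=
  [set z | (a <= Re z <= b) /\ (c <= Im z <= d)].

Lemma compact_box a b c d : compact (box a b c d).
Proof.
have -> : box a b c d = mkC @` (`[a, b] `*` `[c, d]).
  apply/seteqP; split=> [[x y] /= [h1 h2]|_ [[x y] /= [h1 h2] <-]].
    by exists (x, y) => //=; rewrite !in_itv.
  by rewrite !in_itv /= in h1 h2.
apply: continuous_compact; first exact/continuous_subspaceT/continuous_mkC.
by apply: compact_setX; exact: segment_compact.
Qed.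

Lemma hausdorffC : hausdorff_space C.
Proof. exact: norm_hausdorff. Qed.
Lemma bounded_setP (A : set C) :
  bounded_set A <-> exists M : R, forall z, A z -> normc z <= M.
Proof.
rewrite /bounded_set; split.
(* In the order of [R[i]] only numbers with equal imaginary parts are comparable, so the larger
   bound keeps [m']. *)
- case=> [[m m']] [mr] /(_ ((m+1)+i* m')) H.
  have : m +i* m' < (m + 1) +i* m' by rewrite ltcE /= eqxx ltrDl ltr01.
  move=> /H; rewrite /globally => {}H; exists (m + 1) => z /H /=.
  by rewrite normCE lecE /= => /andP[_].
- case=> M AM; exists (M%:C); split; first by rewrite realE !lecE /= !eqxx /= le_total.
  move=> x; rewrite ltcE /= => /andP[/eqP x0 xM] z Az /=.
  rewrite normCE lecE /= x0 eqxx /=.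
  by rewrite (le_trans (AM _ Az)) // ltW.
Qed.

Definition dist1 (z w : C) : R := `|Re z - Re w| + `|Im z - Im w|.

Lemma nbhs_dist1P (z : C) (A : set C) :
  nbhs z A <-> exists2 e : R, 0 < e & forall w : C, dist1 w z < e -> A w.
Proof.
split=> [/nbhs_boxP[e e0 eA]|[e e0 eA]].
  exists e => // w wz; apply: eA.
    by rewrite (le_lt_trans _ wz) // lerDl.
  by rewrite (le_lt_trans _ wz) // lerDr.
apply/nbhs_boxP; exists (e / 2); first by rewrite divr_gt0.
move=> w h1 h2; apply: eA; rewrite /dist1; lra.
Qed.

Lemma open_dist1_ball (z : C) (e : R) : open [set w | dist1 w z < e].
Proof.
rewrite openE => w /= wz; apply/nbhs_dist1P; exists (e - dist1 w z).
  by rewrite subr_gt0.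
move=> v; rewrite /dist1 => h.
have := ler_distD (Re w) (Re v) (Re z); have := ler_distD (Im w) (Im v) (Im z).
move: h; rewrite /dist1 /=; lra.
Qed.

(** Each point has a ball missing the other set; halve its radius. If two halved balls met, the
    triangle inequality would put the centre with the smaller radius into the full ball of the
    other. *)
Lemma separated_open (E0 E1 : set C) : separated E0 E1 ->
  exists U V : set C, [/\ open U, open V, E0 `<=` U, E1 `<=` V & U `&` V = set0].
Proof.
have sep (A B : set C) : A `&` closure B = set0 ->
    forall z, exists r : R, 0 < r /\ (A z -> forall w, dist1 w z < r -> ~ B w).
  move=> AB z; have [Az|] := pselect (A z); last by exists 1; split.
  have : ~ closure B z by move=> Bz; have : (A `&` closure B) z by []; rewrite AB.
  move=> /existsNP[W] /not_implyP[/nbhs_dist1P[e e0 eW]] BW.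
  exists e; split=> // _ w we Bw; apply: BW; exists w; split=> //; exact: eW.
case=> s1 s2.
have [r0 r0P] := choice (sep E0 E1 s2).
have s1' : E1 `&` closure E0 = set0 by rewrite setIC.
have [r1 r1P] := choice (sep E1 E0 s1').
exists (\bigcup_(z in E0) [set w | dist1 w z < r0 z / 2]).
exists (\bigcup_(z in E1) [set w | dist1 w z < r1 z / 2]).
have dzz z : dist1 z z = 0 by rewrite /dist1 !subrr normr0 addr0.
split.
- by apply: bigcup_open => z _; exact: open_dist1_ball.
- by apply: bigcup_open => z _; exact: open_dist1_ball.
- by move=> z Ez; exists z => //=; rewrite dzz divr_gt0 //; case: (r0P z).
- by move=> z Ez; exists z => //=; rewrite dzz divr_gt0 //; case: (r1P z).
- apply/seteqP; split=> // v [[a E0a /= va] [b E1b /= vb]].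
  have dC z w : dist1 z w = dist1 w z by rewrite /dist1 distrC [X in _ + X]distrC.
  have tri : dist1 a b <= dist1 v a + dist1 v b.
    rewrite (dC v a) /dist1.
    have := ler_distD (Re v) (Re a) (Re b); have := ler_distD (Im v) (Im a) (Im b).
    lra.
  have [_ /(_ E0a b) na] := r0P a; have [_ /(_ E1b a) nb] := r1P b.
  have [ab|ba] := leP (r0 a) (r1 b).
    by apply: nb => //; lra.
  by apply: na => //; rewrite dC; lra.
Qed.

Lemma connected_paths (A : set C) (z0 : C) :
  (forall z, A z -> exists g : R -> C, [/\ continuous g, g 0 = z0, g 1 = z &
     forall t, 0 <= t <= 1 -> A (g t)]) -> connected A.
Proof.
move=> AP.
have [->|/set0P[z1 Az1]] := eqVneq A set0; first exact: connected0.
have Az0 : A z0.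
  by have [g [_ g0 _ gA]] := AP _ Az1; rewrite -g0; apply: gA; rewrite lexx ler01.
have gP z : exists g : R -> C, A z -> [/\ continuous g, g 0 = z0, g 1 = z &
     forall t, 0 <= t <= 1 -> A (g t)].
  by have [/AP[g]|] := pselect (A z); [exists g|exists (fun=> 0)].
have [g {}gP] := choice gP.
have -> : A = \bigcup_(z in A) (g z @` `[0, 1]).
  apply/seteqP; split=> [z Az|y [z Az [t /=]]].
    exists z => //; exists 1; rewrite /= ?in_itv /= ?ler01 ?lexx //.
    by case: (gP _ Az).
  by rewrite in_itv /= => t01 <-; case: (gP _ Az) => _ _ _; apply.
apply: bigcup_connected.
  exists z0 => z Az; exists 0; rewrite /= ?in_itv /= ?ler01 ?lexx //.
  by case: (gP _ Az).
move=> z Az; apply: connected_continuous_connected; first exact: segment_connected.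
by apply: continuous_subspaceT; case: (gP _ Az).
Qed.

Lemma connected_star (A : set C) (z0 : C) :
  (forall z t, A z -> 0 <= t <= 1 ->
     A ((Re z0 + t * (Re z - Re z0)) +i* (Im z0 + t * (Im z - Im z0)))) ->
  connected A.
Proof.
move=> AP; apply: (@connected_paths _ z0) => z Az.
exists (fun t => (Re z0 + t * (Re z - Re z0)) +i* (Im z0 + t * (Im z - Im z0))).
split.
- move=> t; apply/cvgCP => /=; split; apply: cvgD; (try exact: cvg_cst);
    by apply: cvgMl; exact: cvg_id.
- by rewrite !mul0r !addr0; case: z0 {AP}.
- by rewrite !mul1r ![_ + (_ - _)]addrC !subrK; case: z {Az}.
- by move=> t t01; exact: AP.
Qed.

Lemma connected_box a b c d : connected (box a b c d).
Proof.
have [->|/set0P[z0 [z0x z0y]]] := eqVneq (box a b c d) set0; first exact: connected0.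
by apply: (@connected_star _ z0) => z t [zx zy] t01; split=> /=; nra.
Qed.

End Topology.

(** * Compactness and connectedness arguments *)

Section Compactness.
Variables T U : topologicalType.

Lemma connected_inj_preimage (K : set T) (f : T -> U) : hausdorff_space U ->
  compact K -> continuous f -> {in K &, injective f} ->
  connected (f @` K) -> connected K.
Proof.
move=> hU cK cf injf cfK B [b Bb] [W oW BW] [D cD BD].
have BK : B `<=` K by rewrite BW; exact: subIsetl.
have imc (A : set T) : compact A -> closed (f @` A).
  move=> cA; apply: compact_closed => //; apply: continuous_compact => //.
  exact: continuous_subspaceT.
have cB : closed (f @` B) by apply: imc; rewrite BD; exact: compact_closedI.
have cB' : closed (f @` (K `&` ~` W)).
  by apply: imc; apply: compact_closedI => //; exact: open_closedC.
have fBE : f @` B = f @` K.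
  apply: cfK; first by exists (f b); exists b.
  - exists (~` (f @` (K `&` ~` W))); first exact: closed_openC.
    apply/seteqP; split=> [_ [x Bx <-]|_ [[x Kx <-] nx]].
      split; first by exists x => //; exact: BK.
      move=> [y [Ky nWy]] fyx; apply: nWy.
      have -> : y = x by apply: injf => //; rewrite inE //; exact: BK.
      by move: Bx; rewrite BW => -[].
    exists x => //; rewrite BW; split=> //; apply: contrapT => nWx.
    by apply: nx; exists x.
  - exists (f @` B) => //; apply/seteqP; split=> [_ [x Bx <-]|y [] //].
    by split; exists x => //; exact: BK.
apply/seteqP; split=> // x Kx.
have : (f @` K) (f x) by exists x.
rewrite -fBE => -[y By fyx].
by have <- : y = x by apply: injf => //; rewrite inE //; exact: BK.
Qed.

(** The part of [K] outside the interior of [V] has a closed image that misses [f z0]. This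
    expresses continuity of an inverse branch at [f z0] without naming the branch. *)
Lemma compact_fiber_nbhs (K : set T) (f : T -> U) (z0 : T) (V : set T) :
  hausdorff_space U -> compact K -> continuous f ->
  (forall z, K z -> f z = f z0 -> z = z0) -> nbhs z0 V ->
  \forall w \near f z0, forall z, K z -> f z = w -> V z.
Proof.
move=> hU cK cf inj0 /nbhs_interior nV.
have cK' : compact (K `&` ~` V^°).
  by apply: compact_closedI => //; apply: open_closedC; exact: open_interior.
have cf' : closed (f @` (K `&` ~` V^°)).
  apply: compact_closed => //; apply: continuous_compact => //.
  exact: continuous_subspaceT.
have : nbhs (f z0) (~` (f @` (K `&` ~` V^°))).
  apply: open_nbhs_nbhs; split; first exact: closed_openC.
  move=> [z [Kz nVz]] /(inj0 _ Kz) zz0; apply: nVz; rewrite zz0.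
  exact: nbhs_singleton.
apply: filterS => w nw z Kz fzw; apply: contrapT => nVz; apply: nw.
by exists z => //; split=> // /interior_subset.
Qed.

End Compactness.

(** The near-covering form of compactness of [K 0] yields one [n] for all points: a point of [O] has
    [O] as neighbourhood, and a point outside [O] has a neighbourhood disjoint from some closed
    [K n]. *)
Lemma bigcap_compact_subset (T : topologicalType) (K : nat -> set T) (O : set T) :
  hausdorff_space T -> (forall n, compact (K n)) ->
  (forall n, K n.+1 `<=` K n) -> open O -> \bigcap_n K n `<=` O ->
  exists n, K n `<=` O.
Proof.
move=> hT cK dK oO KO.
have dK' m n : (m <= n)%N -> K n `<=` K m.
  elim: n => [|n IH]; first by rewrite leqn0 => /eqP->.
  by rewrite leq_eqVlt => /predU1P[->//|]; rewrite ltnS => /IH; exact: subset_trans.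
have /compact_near_coveringP/(_ nat \oo (fun n x => K n x -> O x)) := cK 0%N.
case=> [x K0x|N _ NK]; last first.
  exists N => x Kx; exact: (NK N (leqnn _) x (dK' _ _ (leq0n _) _ Kx) Kx).
have [Ox|nOx] := pselect (O x).
  exists (O, setT); first by split=> /=; [exact: open_nbhs_nbhs|exact: filterT].
  by move=> [y n] [].
have [n nK] : exists n, ~ K n x.
  by apply: contrapT => /forallNP h; apply: nOx; apply: KO => n _; exact: contrapT.
exists (~` K n, [set m | (n <= m)%N]).
  split=> /=; last exact: nbhs_infty_ge.
  apply: open_nbhs_nbhs; split=> //.
  by apply: closed_openC; exact: compact_closed.
by move=> [y m] [/= nKy nm] Kmy; exfalso; apply: nKy; exact: dK' nm _ Kmy.
Qed.

(** A separation of the intersection extends to disjoint open sets. By compactness these already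
    cover some [K n], which is connected and so lies in one of them. *)
Lemma bigcap_connected (R : realType) (K : nat -> set R[i]^o) :
  (forall n, compact (K n)) -> (forall n, connected (K n)) ->
  (forall n, K n.+1 `<=` K n) -> connected (\bigcap_n K n).
Proof.
move=> cK conK dK; apply/connectedP => E [E0 EU sE].
have [U [V [oU oV EfU EtV UV0]]] := separated_open sE.
have [n nUV] : exists n, K n `<=` U `|` V.
  apply: bigcap_compact_subset => //.
      exact: openU.
  by rewrite EU => x [/EfU|/EtV]; [left|right].
have sUV : separated U V.
  split; apply/seteqP; split=> // x [].
    move=> cUx Vx; have [y yUV] := cUx _ (open_nbhs_nbhs (conj oV Vx)).
    by have : (U `&` V) y by []; rewrite UV0.
  move=> Ux cVx; have [y [Vy Uy]] := cVx _ (open_nbhs_nbhs (conj oU Ux)).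
  by have : (U `&` V) y by []; rewrite UV0.
have KE : forall b, exists2 x, K n x & E b x.
  move=> b; have [x Ex] := E0 b; exists x => //.
  have : (\bigcap_k K k) x by rewrite EU; case: b Ex; [right|left].
  exact.
have [KU|KV] := connected_subset sUV nUV (conK n).
  have [x /KU Ux /EtV Vx] := KE true.
  by have : (U `&` V) x by []; rewrite UV0.
have [x /KV Vx /EfU Ux] := KE false.
by have : (U `&` V) x by []; rewrite UV0.
Qed.

Lemma connected_chain (T : topologicalType) (A : nat -> set T) (p : nat -> T)
    (B : set T) (m : nat) :
  (forall i, (i < m)%N -> [/\ connected (A i), A i (p i) & A i (p i.+1)]) ->
  connected B -> B (p 0%N) ->
  connected (B `|` \bigcup_(i in `I_m) A i) /\
  (B `|` \bigcup_(i in `I_m) A i) (p m).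
Proof.
move=> AP cB Bp; elim: m AP => [|m IH] AP.
  by rewrite II0 bigcup_set0 setU0.
have [|cU Up] := IH; first by move=> i im; apply: AP; exact: ltnW.
have [cA Am Am'] := AP m (ltnSn m).
rewrite IIS bigcup_setU bigcup_set1 setUA; split; last by right.
by apply: connectedU => //; exists (p m).
Qed.

(** * The map in real coordinates *)

Section Map.
Variable R : realType.
Local Notation C := (R[i]^o).
Local Notation Re := complex.Re.
Local Notation Im := complex.Im.
Local Notation f := (@dyn_map R).

Lemma Re_dyn_map (z : C) :
  Re (f z) = 2 * Re z + (2 - ln 2) - expR (Re z) * cos (Im z).
Proof.
case: z => x y; rewrite /dyn_map /cexp /=.
rewrite !mul0r !subr0 !addr0; ring.
Qed.

Lemma Im_dyn_map (z : C) : Im (f z) = 2 * Im z - expR (Re z) * sin (Im z).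
Proof.
case: z => x y; rewrite /dyn_map /cexp /=.
rewrite !mul0r !addr0 !subr0; ring.
Qed.

Lemma continuous_dyn_map : continuous (f : C -> C).
Proof.
suff H (z : C) : f @ z --> (f z : C) by move=> z; exact: H.
apply: (cvgCP (F := nbhs z) f (f z)).2.
have cRe : Re w @[w --> z] --> Re z by exact: continuous_Re.
have cIm : Im w @[w --> z] --> Im z by exact: continuous_Im.
have cexp : expR (Re w) @[w --> z] --> expR (Re z).
  by apply: (continuous_comp (@continuous_Re R z)); exact: continuous_expR.
have ccos : cos (Im w) @[w --> z] --> cos (Im z).
  by apply: (continuous_comp (@continuous_Im R z)); exact: continuous_cos.
have csin : sin (Im w) @[w --> z] --> sin (Im z).
  by apply: (continuous_comp (@continuous_Im R z)); exact: continuous_sin.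
split.
  have h : 2 * Re w + (2 - ln 2) - expR (Re w) * cos (Im w) @[w --> z] -->
      2 * Re z + (2 - ln 2) - expR (Re z) * cos (Im z).
    exact: (cvgB (cvgD (cvgM (cvg_cst _) cRe) (cvg_cst _)) (cvgM cexp ccos)).
  rewrite Re_dyn_map; apply: cvg_trans h; apply: near_eq_cvg; apply: nearW => w.
  by rewrite Re_dyn_map.
have h : 2 * Im w - expR (Re w) * sin (Im w) @[w --> z] -->
    2 * Im z - expR (Re z) * sin (Im z).
  exact: cvgB (cvgM (cvg_cst _) cIm) (cvgM cexp csin).
rewrite Im_dyn_map; apply: cvg_trans h; apply: near_eq_cvg; apply: nearW => w.
by rewrite Im_dyn_map.
Qed.

Lemma ln2_bounds : 0 < ln (2 : R) < 1.
Proof.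
have e2 : (2 : R) < expR 1 by have := expR_gt1Dx (oner_neq0 R).
apply/andP; split; first by rewrite ln_gt0 // ltr1n.
by rewrite -ltr_expR lnK // posrE.
Qed.

(** The difference [sin x - x * cos x] vanishes at 0 and has derivative [x * sin x], which is
    nonnegative on [[0, pi]]. *)
Lemma mul_cos_le_sin (y : R) : 0 <= y <= pi -> y * cos y <= sin y.
Proof.
move=> /andP[y0 ypi].
have d (x : R) : is_derive x 1 (fun x => sin x - x * cos x) (x * sin x).
  apply: (is_derive_eq (is_deriveB (is_derive_sin x)
    (is_deriveM (is_derive_id x 1) (is_derive_cos x)))).
  rewrite /= /GRing.scale /=; ring.
have [|c] := @MVT_segment R (fun x => sin x - x * cos x) (fun x => x * sin x)
  0 y y0 (fun x _ => d x).
  apply: derivable_within_continuous => x _.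
  by have [] := d x.
rewrite in_itv /= sin0 mul0r !subr0 => /andP[c0 cy] h.
rewrite -subr_ge0 h mulr_ge0 // mulr_ge0 // sin_ge0_pi // c0 /=.
exact: le_trans cy ypi.
Qed.

Lemma sin_le_id (y : R) : 0 <= y -> sin y <= y.
Proof.
move=> y0.
have d (x : R) : is_derive x 1 (fun x => x - sin x) (1 - cos x).
  exact: (is_deriveB (is_derive_id x 1) (is_derive_sin x)).
have [|c] := @MVT_segment R (fun x => x - sin x) (fun x => 1 - cos x) 0 y y0 (fun x _ => d x).
  apply: derivable_within_continuous => x _.
  by have [] := d x.
rewrite sin0 !subr0 => _ h.
by rewrite -subr_ge0 h mulr_ge0 // subr_ge0 cos_le1.
Qed.

(** The action of [f] on real parts along each line [Im z = 2 pi k]. It increases up to [ln 2],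
    where it has a fixed point and its maximum, and decreases afterwards. *)
Definition phi (x : R) := 2 * x + (2 - ln 2) - expR x.

(** The convexity bound [1 + t <= expR t] takes the place of the sign of the derivative
    [2 - expR x]. *)
Lemma phi_lt (x x' : R) : ln 2 <= x -> x < x' -> phi x' < phi x.
Proof.
move=> x2 xx'; have x2' : 2 <= expR x by rewrite -[2]lnK ?posrE // ler_expR.
have : 1 + (x' - x) <= expR (x' - x) by exact: expR_ge1Dx.
have : expR x' = expR x * expR (x' - x) by rewrite -expRD addrC subrK.
have : x' - x != 0 by rewrite subr_eq0 gt_eqF.
move=> /expR_gt1Dx; rewrite /phi; nra.
Qed.

Lemma phi_le_left (x x' : R) : x <= x' -> x' <= ln 2 -> phi x <= phi x'.
Proof.
move=> xx' x2; have x2' : expR x' <= 2 by rewrite -[leRHS]lnK ?posrE // ler_expR.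
have : 1 + (x - x') <= expR (x - x') by exact: expR_ge1Dx.
have : expR x = expR x' * expR (x - x') by rewrite -expRD addrC subrK.
have := expR_gt0 x'; rewrite /phi; nra.
Qed.

Lemma phi_le_ln2 (x : R) : phi x <= ln 2.
Proof.
have : 1 + (x - ln 2) <= expR (x - ln 2) by exact: expR_ge1Dx.
have : expR x = 2 * expR (x - ln 2).
  by rewrite -{1}[2]lnK ?posrE // -expRD addrC subrK.
rewrite /phi; nra.
Qed.

Lemma continuous_phi : continuous phi.
Proof.
move=> x; apply: cvgB; last exact: continuous_expR.
by apply: cvgD; [exact: cvgM (cvg_cst _) cvg_id|exact: cvg_cst].
Qed.

Lemma expR_ge_sqr (x : R) : 0 <= x -> 1 + x ^+ 2 / 2 <= expR x.
Proof. by move=> /(expR_ge1Dxn 1). Qed.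

Lemma phi_surj (u : R) : u <= ln 2 -> exists2 x, ln 2 <= x & phi x = u.
Proof.
move=> u2.
have /andP[l0 l1] := ln2_bounds.
(* At [x = 7 - u] the bound [1 + x^2 / 2] for [expR x] outweighs the linear terms of [phi x - u], so
   [7 - u] can be the right end of the interval. *)
have b0 : 0 <= 7 - u by lra.
have e := expR_ge_sqr b0.
have pu : phi (7 - u) <= u by rewrite /phi; nra.
have pl : phi (ln 2) = ln 2 by rewrite /phi lnK ?posrE //; lra.
have [|||x] := @IVT R phi (ln 2) (7 - u) u; first by lra.
- exact/continuous_subspaceT/continuous_phi.
- rewrite pl; apply/andP; split; first by rewrite ge_min pu orbT.
  by rewrite le_max u2.
by rewrite in_itv /= => /andP[lx _] <-; exists x.
Qed.

Lemma is_derive_affine (a b t : R) : is_derive t 1 (fun t => a + t * b) b.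
Proof.
apply: (is_derive_eq (is_deriveD (is_derive_cst a t 1)
  (is_deriveM (is_derive_id t 1) (is_derive_cst b t 1)))).
by rewrite /= /GRing.scale /=; ring.
Qed.

(* For [h := z2 - z1] the function [t |-> Im (f (z1 + t h) * conj h)] has
   derivative [|h|^2 * Im f'], and [Im f' = - e^x sin y] has a sign on the
   half strip. *)
Lemma dyn_map_inj_half (z1 z2 : C) : 0 <= Im z1 <= pi -> 0 <= Im z2 <= pi ->
  f z1 = f z2 -> z1 = z2 \/ (Im z1 = 0 /\ Im z2 = 0).
Proof.
case: z1 z2 => [x1 y1] [x2 y2] /= Y1 Y2 fE.
have := congr1 (@complex.Re R) fE; have := congr1 (@complex.Im R) fE.
rewrite (Re_dyn_map (x1 +i* y1)) (Re_dyn_map (x2 +i* y2)).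
rewrite (Im_dyn_map (x1 +i* y1)) (Im_dyn_map (x2 +i* y2)) /= => fI fR.
pose a := x2 - x1; pose b := y2 - y1.
pose g t := a * (2 * (y1 + t * b) - expR (x1 + t * a) * sin (y1 + t * b)) -
  b * (2 * (x1 + t * a) - expR (x1 + t * a) * cos (y1 + t * b)).
pose dg t := - (expR (x1 + t * a) * sin (y1 + t * b) * (a ^+ 2 + b ^+ 2)).
have dG (t : R) : is_derive t 1 g (dg t).
  have dX := is_derive_affine x1 a t; have dY := is_derive_affine y1 b t.
  have dE := is_derive1_comp (g := fun t => x1 + t * a) (is_derive_expR _) dX.
  have dS := is_derive1_comp (g := fun t => y1 + t * b) (is_derive_sin _) dY.
  have dC := is_derive1_comp (g := fun t => y1 + t * b) (is_derive_cos _) dY.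
  have d2 := is_derive_cst (2 : R) t (1 : R).
  have da := is_derive_cst a t (1 : R).
  have db := is_derive_cst b t (1 : R).
  have D := is_deriveB (is_deriveM da (is_deriveB (is_deriveM d2 dY) (is_deriveM dE dS)))
    (is_deriveM db (is_deriveB (is_deriveM d2 dX) (is_deriveM dE dC))).
  apply: (is_derive_eq D).
  by rewrite /= /GRing.scale /= /dg; ring.
have [|c c01] := @MVT R g dg 0 1 ltr01 (fun x _ => dG x).
  apply: derivable_within_continuous => x _.
  by have [] := dG x.
(* The two values differ by [a * Im - b * Re] of [f z2 - f z1], which is 0. *)
have -> : g 1 - g 0 = 0.
  rewrite /g !mul1r !mul0r !addr0 /a /b !(addrC x1) !(addrC y1) !subrK.
  by nra.
move: c01; rewrite in_itv /= subr0 mulr1 => /andP[c0 c1] /esym/eqP.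
rewrite /dg oppr_eq0 !mulf_eq0 gt_eqF ?expR_gt0 //= => /orP[/eqP s0|]; last first.
  rewrite paddr_eq0 ?sqr_ge0 // !expf_eq0 /= !subr_eq0 => /andP[/eqP <- /eqP <-].
  by left.
have yc : 0 <= y1 + c * b <= pi by apply/andP; rewrite /b; split; nra.
(* At an interior point of the segment [sin] vanishes only if the whole segment lies on [Im = 0] or
   on [Im = pi]. *)
have [y0|y0] := eqVneq (y1 + c * b) 0.
  right; split; rewrite /b in y0; nra.
have [yp|yp] := eqVneq (y1 + c * b) pi; last first.
  have : 0 < sin (y1 + c * b).
    by apply: sin_gt0_pi; rewrite !lt_neqAle eq_sym y0 yp.
  by rewrite s0 ltxx.
have y1p : y1 = pi by rewrite /b in yp; nra.
have y2p : y2 = pi by rewrite /b in yp; nra.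
(* On the line [Im = pi] the real part of [f] is [2 x + 2 - ln 2 + expR x], strictly increasing in
   [x]. *)
left; congr (_ +i* _); last by rewrite y1p y2p.
move: fR; rewrite y1p y2p cospi !mulrN1 !opprK => fR.
case: (ltgtP x1 x2) => // xx.
  have : expR x1 < expR x2 by rewrite ltr_expR.
  by lra.
have : expR x2 < expR x1 by rewrite ltr_expR.
by lra.
Qed.

(** * Solving [f z = w] in a half strip *)

Lemma near_pick_right (a b : R) (P : set R) : nbhs a P -> a < b ->
  exists y, a < y < b /\ P y.
Proof.
case/nbhs_ballP => e /= e0 eP ab.
pose y := Num.min (a + e / 2) ((a + b) / 2).
have ay : a < y by rewrite lt_min; apply/andP; split; lra.
have yb : y < b by rewrite gt_min; apply/orP; right; lra.
have ye : y <= a + e / 2 by rewrite ge_min lexx.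
exists y; split; first by rewrite ay.
by apply: eP; rewrite /ball /= distrC gtr0_norm ?subr_gt0 //; lra.
Qed.

Lemma near_pick_left (a b : R) (P : set R) : nbhs b P -> a < b ->
  exists y, a < y < b /\ P y.
Proof.
case/nbhs_ballP => e /= e0 eP ab.
pose y := Num.max (b - e / 2) ((a + b) / 2).
have yb : y < b by rewrite gt_max; apply/andP; split; lra.
have ay : a < y by rewrite lt_max; apply/orP; right; lra.
have ye : b - e / 2 <= y by rewrite le_max lexx.
exists y; split; first by rewrite ay.
by apply: eP; rewrite /ball /= gtr0_norm ?subr_gt0 //; lra.
Qed.

Lemma near_lt (g h : R -> R) (a : R) : {for a, continuous g} ->
  {for a, continuous h} -> g a < h a -> \forall y \near a, g y < h y.
Proof.
move=> cg ch gh.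
have : (h y - g y) @[y --> a] --> h a - g a by exact: cvgB.
move/cvgrPdist_lt => /(_ (h a - g a)); rewrite subr_gt0 => /(_ gh).
apply: filterS => y; rewrite ltr_norml; lra.
Qed.

(* On the curve [e^x = (2y - v) / sin y] the imaginary part of [f] equals [v],
   so only the real part remains to be solved for. *)
Definition level_abs (v y : R) := (2 * y - v) / sin y.
Definition level_Re (v y : R) :=
  2 * ln (level_abs v y) + (2 - ln 2) - level_abs v y * cos y.

Lemma level_abs_gt0 (v y : R) : 0 < y < pi -> v < 2 * y -> 0 < level_abs v y.
Proof. by move=> y0 vy; rewrite divr_gt0 ?sin_gt0_pi // subr_gt0. Qed.

Lemma continuous_level_Re (v y : R) : 0 < y < pi -> v < 2 * y ->
  {for y, continuous (level_Re v)}.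
Proof.
move=> y0 vy; have s0 := sin_gt0_pi y0.
have cl : {for y, continuous (level_abs v)}.
  apply: cvgM.
    by apply: cvgB; [exact: cvgM (cvg_cst _) cvg_id|exact: cvg_cst].
  by apply: cvgV; [rewrite gt_eqF|exact: continuous_sin].
have cln : {for y, continuous (@ln R \o level_abs v)}.
  by apply: continuous_comp => //; apply: continuous_ln; exact: level_abs_gt0.
apply: cvgB; last by apply: cvgM => //; exact: continuous_cos.
by apply: cvgD; [exact: cvgM (cvg_cst _) cln|exact: cvg_cst].
Qed.

(** As [y] tends to [pi], [2 y - v] stays positive while [sin y] tends to 0, so [level_abs] tends to
    infinity; near [pi] the factor [- cos y] is positive. *)
Lemma level_Re_high (u v : R) : v < 2 * pi ->
  exists y, [/\ 0 < y < pi, v < 2 * y & u <= level_Re v y].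
Proof.
move=> vpi; have pi0 := pi_gt0 R.
have /andP[l0 l1] := ln2_bounds.
have n1 : \forall y \near (pi : R), cos y < 0.
  apply: near_lt; [exact: continuous_cos|exact: cvg_cst|rewrite cospi; lra].
have n2 : \forall y \near (pi : R), expR (u / 2) * sin y < 2 * y - v.
  apply: near_lt.
  - by apply: cvgM; [exact: cvg_cst|exact: continuous_sin].
  - by apply: cvgB; [exact: cvgM (cvg_cst _) cvg_id|exact: cvg_cst].
  - by rewrite sinpi mulr0 subr_gt0.
have [y [/andP[y0 y1] [c0 h]]] := near_pick_left (filterI n1 n2) pi0.
have y01 : 0 < y < pi by rewrite y0.
have s0 := sin_gt0_pi y01.
have vy : v < 2 * y by have := expR_gt0 (u / 2); nra.
exists y; split=> //.
have t0 := level_abs_gt0 y01 vy.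
have tE : expR (u / 2) <= level_abs v y by rewrite ler_pdivlMr // ltW.
have : u / 2 <= ln (level_abs v y) by rewrite -ler_expR lnK.
rewrite /level_Re; nra.
Qed.

(** For [v < 0] let [y] tend to 0: [level_abs] tends to infinity and outweighs its logarithm. For
    [v > 0] let [y] tend to [v / 2]: the logarithm tends to minus infinity. For [v = 0] the limit at
    0 is [ln 2 < u]. *)
Lemma level_Re_low (u v b : R) : v < 2 * pi -> ~ (v = 0 /\ u <= ln 2) ->
  0 < b <= pi -> v < 2 * b ->
  exists y, [/\ 0 < y < b, v < 2 * y & level_Re v y <= u].
Proof.
move=> vpi nv /andP[b0 bpi] vb; have pi0 := pi_gt0 R.
have /andP[l0 l1] := ln2_bounds.
have cl (a : R) : {for a, continuous (fun y : R => 2 * y - v)}.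
  by apply: cvgB; [exact: cvgM (cvg_cst _) cvg_id|exact: cvg_cst].
have cs (a k : R) : {for a, continuous (fun y : R => k * sin y)}.
  by apply: cvgM; [exact: cvg_cst|exact: continuous_sin].
have [v0|v0|v0] := ltgtP v 0.
(* With [L] the logarithm of [level_abs], half of [1 + L^2 / 2] exceeds [2 L + 2 + |u|] once
   [L >= 12 + |u|]. *)
- pose X := 12 + `|u|.
  have n1 : \forall y \near (0 : R), 1 / 2 < cos y.
    apply: near_lt; [exact: cvg_cst|exact: continuous_cos|rewrite cos0; lra].
  have n2 : \forall y \near (0 : R), expR X * sin y < 2 * y - v.
    by apply: near_lt; [exact: cs|exact: cl|rewrite sin0; lra].
  have [y [/andP[y0 yb] [c0 h]]] := near_pick_right (filterI n1 n2) b0.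
  have y01 : 0 < y < pi by rewrite y0 (lt_le_trans yb).
  have vy : v < 2 * y by lra.
  exists y; split=> //; first by rewrite y0.
  have t0 := level_abs_gt0 y01 vy.
  have s0 := sin_gt0_pi y01.
  have tE : expR X <= level_abs v y by rewrite ler_pdivlMr // ltW.
  have lX : X <= ln (level_abs v y) by rewrite -ler_expR lnK.
  have : 1 + ln (level_abs v y) ^+ 2 / 2 <= level_abs v y.
    rewrite -[leRHS]lnK ?posrE //; apply: expR_ge_sqr.
    by rewrite (le_trans _ lX) // /X addr_ge0.
  have := normr_ge0 u; have := ler_norm (- u); rewrite normrN.
  rewrite /level_Re; move: lX; rewrite /X; nra.
- pose X := 3 + `|u|.
  have v2pi : 0 < v / 2 < pi by apply/andP; split; lra.
  have n2 : \forall y \near v / 2, 2 * y - v < expR (- X) * sin y.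
    apply: near_lt; [exact: cl|exact: cs|].
    rewrite [X in X < _](_ : _ = 0); last by lra.
    by rewrite mulr_gt0 ?expR_gt0 ?sin_gt0_pi.
  have vb2 : v / 2 < b by lra.
  have [y [/andP[y0 yb] h]] := near_pick_right n2 vb2.
  have y01 : 0 < y < pi by apply/andP; split; lra.
  have vy : v < 2 * y by lra.
  exists y; split=> //; first by apply/andP; split; lra.
  have t0 := level_abs_gt0 y01 vy.
  have s0 := sin_gt0_pi y01.
  have tE : level_abs v y <= expR (- X) by rewrite ler_pdivrMr // ltW.
  have lX : ln (level_abs v y) <= - X by rewrite -ler_expR lnK.
  have e1 : expR (- X) <= 1 by rewrite expR_le1 /X; have := normr_ge0 u; lra.
  have := cos_geN1 y; have := normr_ge0 u; have := ler_norm (- u).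
  rewrite normrN /level_Re; move: lX; rewrite /X; nra.
- have u2 : ln 2 < u by rewrite ltNge; apply/negP => u2; apply: nv.
  have cc (a : R) : {for a, continuous (fun y : R => 1 - cos y)}.
    by apply: cvgB; [exact: cvg_cst|exact: continuous_cos].
  have n1 : \forall y \near (0 : R), 1 / 2 < cos y.
    apply: near_lt; [exact: cvg_cst|exact: continuous_cos|rewrite cos0; lra].
  have n2 : \forall y \near (0 : R),
      4 * (1 - cos y) < (u - ln 2) * (1 / 2).
    apply: near_lt; [exact: cvgM (cvg_cst _) (cc _)|exact: cvg_cst|].
    rewrite cos0; lra.
  have [y [/andP[y0 yb] [c0 h]]] := near_pick_right (filterI n1 n2) b0.
  have y01 : 0 < y < pi by rewrite y0 (lt_le_trans yb).
  have vy : v < 2 * y by lra.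
  exists y; split=> //; first by rewrite y0.
  have t0 := level_abs_gt0 y01 vy.
  have s0 := sin_gt0_pi y01.
  have s1 : sin y <= y by apply: sin_le_id; exact: ltW.
  have s2 : y * cos y <= sin y.
    by apply: mul_cos_le_sin; case/andP: y01 => ? ?; rewrite !ltW.
  have c1 := cos_le1 y.
  have tl : 2 <= level_abs v y by rewrite ler_pdivlMr //; lra.
  have tu : level_abs v y * cos y <= 2.
    rewrite /level_abs mulrAC ler_pdivrMr //; rewrite v0; lra.
  have lnt : ln (level_abs v y) - ln 2 <= level_abs v y / 2 - 1.
    rewrite -ln_div ?posrE //.
    have := @expR_ge1Dx R (ln (level_abs v y / 2)).
    rewrite lnK ?posrE ?divr_gt0 //; lra.
  rewrite /level_Re; nra.
Qed.

(** For [v = 2 pi] the preimage is found on [Im = pi]; for [v = 0] and [u <= ln 2] on the real axis,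
    on the decreasing branch of [phi]; otherwise by the intermediate value theorem along the level
    curve. *)
Lemma dyn_map_surj_half (w : C) : Im w <= 2 * pi ->
  exists z : C, [/\ 0 <= Im z <= pi, f z = w & Im z = 0 -> ln 2 <= Re z].
Proof.
case: w => u v /= vpi; have pi0 := pi_gt0 R.
have /andP[l0 l1] := ln2_bounds.
have fE (x y : R) : 2 * x + (2 - ln 2) - expR x * cos y = u ->
    2 * y - expR x * sin y = v -> f (x +i* y) = u +i* v.
  move=> fR fI; have hR := Re_dyn_map (x +i* y); have hI := Im_dyn_map (x +i* y).
  by case: (f _) hR hI => a b /= -> ->; congr (_ +i* _).
have [vE|vE] := eqVneq v (2 * pi).
  pose g (x : R) := 2 * x + (2 - ln 2) + expR x.
  have cg : continuous g.
    move=> x; apply: cvgD; last exact: continuous_expR.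
    by apply: cvgD; [exact: cvgM (cvg_cst _) cvg_id|exact: cvg_cst].
  have e0 : expR (- `|u| - 3) <= 1.
    by rewrite expR_le1; have := normr_ge0 u; lra.
  have lo : g (- `|u| - 3) <= u.
    by have := normr_ge0 u; have := ler_norm (- u); rewrite normrN /g; lra.
  have hi : u <= g `|u|.
    rewrite /g; have := ler_norm u; have := expR_gt0 `|u|; have := normr_ge0 u; lra.
  have [|||x _ gx] := @IVT R g (- `|u| - 3) `|u| u.
  - by have := normr_ge0 u; lra.
  - exact: continuous_subspaceT.
  - by rewrite ge_min lo le_max hi orbT.
  exists (x +i* pi); split=> //=; first by rewrite lexx ltW.
    by apply: fE; rewrite ?cospi ?sinpi ?mulr0 ?subr0 // -gx /g; ring.
  by move=> p0; move: pi0; rewrite p0 ltxx.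
have [[v0 u2]|nv] := pselect (v = 0 /\ u <= ln 2).
  have [x x2 phix] := phi_surj u2.
  exists (x +i* 0); split=> //=; first by rewrite lexx ltW.
  by apply: fE; rewrite ?cos0 ?sin0 ?mulr1 ?mulr0 ?subr0 // -phix.
have {}vpi : v < 2 * pi by rewrite lt_neqAle vE.
have [b [/andP[b0 bpi] vb hb]] := level_Re_high u vpi.
have [a [/andP[a0 ab] va ha]] : exists y,
    [/\ 0 < y < b, v < 2 * y & level_Re v y <= u].
  by apply: level_Re_low => //; rewrite b0 ltW.
have [|||y] := @IVT R (level_Re v) a b u; first exact: ltW.
- apply: continuous_in_subspaceT => y; rewrite inE /= in_itv /= => /andP[y1 y2].
  by apply: continuous_level_Re; [apply/andP; split|]; lra.
- by rewrite ge_min ha le_max hb orbT.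
rewrite in_itv /= => /andP[y1 y2] yE.
have y01 : 0 < y < pi by apply/andP; split; lra.
have vy : v < 2 * y by lra.
have t0 := level_abs_gt0 y01 vy.
have s0 := sin_gt0_pi y01.
exists (ln (level_abs v y) +i* y); split=> /=.
- by apply/andP; split; lra.
- apply: fE; rewrite lnK ?posrE //.
  by rewrite /level_abs divfK ?gt_eqF //; ring.
- by move=> y0; move: y01; rewrite y0 ltxx.
Qed.

End Map.

(** * Horizontal strips *)

Section Rows.
Variable R : realType.
Local Notation C := (R[i]^o).
Local Notation Re := complex.Re.
Local Notation Im := complex.Im.
Local Notation f := (@dyn_map R).

Definition tau : R := pi *+ 2.

Lemma tauE : tau = 2 * pi.
Proof. by rewrite /tau mulr_natl. Qed.

Lemma tau_ge4 : 4 <= tau.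
Proof. by rewrite tauE; have := pi_ge2 R; lra. Qed.

Lemma tau_lt8 : tau < 8.
Proof. by rewrite tauE; have := pihalf_lt2 R; lra. Qed.

Lemma sinD_tauM (y : R) (k : int) : sin (y + tau * k%:~R) = sin y.
Proof.
case: k => n; first by rewrite -pmulrn mulr_natr (periodicn (sinD2pi (R:=R))).
rewrite NegzE mulrNz mulrN -pmulrn mulr_natr.
by rewrite -(periodicn (sinD2pi (R:=R)) n.+1 (_ - _)) subrK.
Qed.

Lemma cosD_tauM (y : R) (k : int) : cos (y + tau * k%:~R) = cos y.
Proof.
case: k => n; first by rewrite -pmulrn mulr_natr (periodicn (cosD2pi (R:=R))).
rewrite NegzE mulrNz mulrN -pmulrn mulr_natr.
by rewrite -(periodicn (cosD2pi (R:=R)) n.+1 (_ - _)) subrK.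
Qed.

Lemma complex_ext (z w : C) : Re z = Re w -> Im z = Im w -> z = w.
Proof. by case: z w => [? ?] [? ?] /= -> ->. Qed.

Definition vshift (k : int) (z : C) : C := Re z +i* (Im z + tau * k%:~R).
Definition flip (z : C) : C := Re z +i* (tau - Im z).

Lemma flipK : involutive flip.
Proof. by move=> z; apply: complex_ext => //=; rewrite subKr. Qed.

Lemma dyn_map_vshift k z : f (vshift k z) = vshift (2 * k) (f z).
Proof.
apply: complex_ext.
  by rewrite (Re_dyn_map (vshift k z)) /= cosD_tauM -Re_dyn_map.
rewrite (Im_dyn_map (vshift k z)) /= sinD_tauM Im_dyn_map intrM; ring.
Qed.

(** [flip] is the reflection in [Im z = pi]; it carries results on the lower half of a strip over to
    the upper half. *)
Lemma dyn_map_flip z : f (flip z) = Re (f z) +i* (2 * tau - Im (f z)).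
Proof.
have e (y : R) : tau - y = - y + tau * 1%:~R by rewrite mulr1 addrC.
apply: complex_ext.
  by rewrite (Re_dyn_map (flip z)) /= e cosD_tauM cosN -Re_dyn_map.
by rewrite (Im_dyn_map (flip z)) /= e sinD_tauM sinN Im_dyn_map; ring.
Qed.

Lemma dyn_map_line (z : C) (k : int) : Im z = tau * k%:~R ->
  f z = phi (Re z) +i* (2 * (tau * k%:~R)).
Proof.
move=> zk; apply: complex_ext; rewrite ?Re_dyn_map ?Im_dyn_map zk -[tau * _]add0r.
  by rewrite cosD_tauM cos0 mulr1.
by rewrite sinD_tauM sin0 mulr0 subr0 add0r.
Qed.

Definition strip (k : int) (z : C) := tau * k%:~R <= Im z <= tau * (k + 1)%:~R.

Lemma strip_vshift k l z : strip k (vshift l z) <-> strip (k - l) z.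
Proof.
rewrite /strip /= !intrD !intrN mulrDr mulrDr.
rewrite /strip !mulrDr mulrN; split=> /andP[h1 h2]; apply/andP; split; lra.
Qed.

Lemma Im_lower_half z : 0 <= Im z <= pi -> Im (f z) <= 2 * Im z.
Proof.
move=> zpi; rewrite Im_dyn_map; have := sin_ge0_pi zpi; have := expR_gt0 (Re z).
nra.
Qed.

(** Points of different halves have different images: [Im (f z)] is at most [2 pi] on the lower half
    and larger than [2 pi] above it. Within one half the injectivity on half strips applies, after a
    reflection for the upper one. *)
Lemma dyn_map_inj_strip z1 z2 : 0 <= Im z1 <= tau -> 0 <= Im z2 <= tau ->
  f z1 = f z2 -> z1 = z2 \/ (Im z1 = Im z2 /\ (Im z1 = 0 \/ Im z1 = tau)).
Proof.
rewrite tauE => h1 h2 fE; have pi0 := pi_gt0 R.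
have hl z : 0 <= Im z <= 2 * pi -> ~~ (Im z <= pi) -> 0 <= Im (flip z) <= pi.
  by rewrite -ltNge /= tauE => /andP[a b] c; apply/andP; split; lra.
have up z : 0 <= Im z <= 2 * pi -> ~~ (Im z <= pi) -> 2 * Im z <= Im (f z).
  move=> a b; have := Im_lower_half (hl _ a b).
  rewrite dyn_map_flip /= tauE; lra.
have [l1|u1] := boolP (Im z1 <= pi); have [l2|u2] := boolP (Im z2 <= pi).
- case/andP: h1 => h1 _; case/andP: h2 => h2 _.
  have {}l1 : 0 <= Im z1 <= pi by rewrite h1.
  have {}l2 : 0 <= Im z2 <= pi by rewrite h2.
  have [->|[a b]] := dyn_map_inj_half l1 l2 fE; first by left.
  by right; rewrite a b; split=> //; left.
- have := up _ h2 u2; rewrite -fE; case/andP: h1 => h1 _.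
  have := @Im_lower_half z1; rewrite h1 l1 => /(_ isT).
  move: u2; rewrite -ltNge; lra.
- have := up _ h1 u1; rewrite fE; case/andP: h2 => h2 _.
  have := @Im_lower_half z2; rewrite h2 l2 => /(_ isT).
  move: u1; rewrite -ltNge; lra.
- have rE : f (flip z1) = f (flip z2) by rewrite !dyn_map_flip fE.
  have [E|[a b]] := dyn_map_inj_half (hl _ h1 u1) (hl _ h2 u2) rE.
    by left; rewrite -[z1]flipK E flipK.
  by move: a b => /=; rewrite tauE => a b; right; split; [|right]; lra.
Qed.

Lemma strip_inj k z1 z2 : strip k z1 -> strip k z2 -> f z1 = f z2 ->
  z1 = z2 \/ (Im z1 = Im z2 /\
    exists l : int, Im z1 = tau * l%:~R).
Proof.
move=> r1 r2 fE.
pose s z := vshift (- k) z.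
have sK z : vshift k (s z) = z.
  by apply: complex_ext => //=; rewrite intrN mulrN subrK.
have rs z : strip k z -> 0 <= Im (s z) <= tau.
  rewrite /strip /= intrD intrN mulrDr mulrN mulr1 => /andP[a b].
  by apply/andP; split; lra.
have fs : f (s z1) = f (s z2) by rewrite !dyn_map_vshift fE.
have [E|[E h]] := dyn_map_inj_strip (rs _ r1) (rs _ r2) fs.
  by left; rewrite -[z1]sK E sK.
have E' : Im z1 = Im z2 by move: E => /= /addIr.
right; split=> //; case: h => /=; rewrite intrN mulrN => h.
  by exists k; lra.
by exists (k + 1); rewrite intrD mulrDr mulr1; lra.
Qed.

Lemma strip_inj_right k z1 z2 : strip k z1 -> strip k z2 -> f z1 = f z2 ->
  ln 2 <= Re z1 -> ln 2 <= Re z2 -> z1 = z2.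
Proof.
move=> r1 r2 fE x1 x2; have [//|[E [l El]]] := strip_inj r1 r2 fE.
have := congr1 (@complex.Re R) fE.
rewrite (dyn_map_line El) (@dyn_map_line z2 l) -?E //= => pE.
apply: complex_ext => //; case: (ltgtP (Re z1) (Re z2)) => // h.
  by have := phi_lt x1 h; rewrite pE ltxx.
by have := phi_lt x2 h; rewrite pE ltxx.
Qed.

(** Injectivity can fail only on a line of the family, where [Re (f z)] is a value of [phi] and so
    at most [ln 2]. *)
Lemma strip_inj_Re k z1 z2 : strip k z1 -> strip k z2 -> f z1 = f z2 ->
  ln 2 < Re (f z1) -> z1 = z2.
Proof.
move=> r1 r2 fE h; have [//|[E [l El]]] := strip_inj r1 r2 fE.
by move: h; rewrite (dyn_map_line El) /= ltNge phi_le_ln2.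
Qed.

(** A translation reduces to the strip [0 <= Im z <= tau], and targets above [Im = 2 pi] are
    reflected. The last clause selects the branch of [phi] on which preimages on a line are
    unique. *)
Lemma dyn_map_surj_strip (k : int) (w : C) : exists z : C, [/\ strip k z, f z = w &
  (exists l : int, Im z = tau * l%:~R) -> ln 2 <= Re z].
Proof.
have pi0 := pi_gt0 R.
suff S (v : C) : exists z : C, [/\ 0 <= Im z <= tau, f z = v &
    Im z = 0 \/ Im z = tau -> ln 2 <= Re z].
  have [z [z1 z2 z3]] := S (vshift (- (2 * k)) w); exists (vshift k z); split.
  - apply/strip_vshift; rewrite subrr /strip !mulr0z mulr0 add0r mulr1z mulr1.
    by case/andP: z1 => -> ->.
  - by rewrite dyn_map_vshift z2; apply: complex_ext => //=; rewrite !intrN mulrN subrK.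
  - move=> [l /= lE]; apply: z3.
    have {}lE : Im z = tau * (l - k)%:~R by rewrite intrB mulrBr -lE addrK.
    move: z1; rewrite lE; have t4 := tau_ge4.
    have tp : 0 < tau by lra.
    rewrite pmulr_rge0 // ger_pMr // => /andP[].
    rewrite ler0z lerz1.
    case: (l - k)%R => [[|[|n]]|n] // _ _; [left|right]; by rewrite ?mulr0 ?mulr1.
have [vl|vu] := leP (Im v) (2 * pi).
  have [z [z1 z2 z3]] := dyn_map_surj_half vl; exists z; split=> //.
    by rewrite tauE; case/andP: z1 => a b; apply/andP; split; lra.
  by case=> // zt; move: z1; rewrite zt tauE => /andP[a b]; lra.
have vl : Im (Re v +i* (2 * tau - Im v)) <= 2 * pi by rewrite /= tauE; lra.
have [z [z1 z2 z3]] := dyn_map_surj_half vl; exists (flip z); split.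
- by rewrite /= tauE; case/andP: z1 => a b; apply/andP; split; lra.
- by rewrite dyn_map_flip z2; apply: complex_ext => //=; rewrite subKr.
- move=> /= [zt|zt].
    by case/andP: z1 => a b; move: zt; rewrite tauE; lra.
  by apply: z3; lra.
Qed.

(** Let [y] be the height above the lower line. As [expR x < 1], both [expR x * sin y < y] and
    [- expR x * sin y < tau - y] hold, and [2 y - expR x * sin y] lies strictly between 0 and
    [2 tau]. *)
Lemma strip_left_image k z : strip k z -> ~ (exists l : int, Im z = tau * l%:~R) ->
  Re z < 0 -> 2 * (tau * k%:~R) < Im (f z) < 2 * (tau * (k + 1)%:~R).
Proof.
move=> rk nl x0.
have e1 : expR (Re z) < 1 by rewrite expR_lt1.
pose y := Im z - tau * k%:~R.
have yE : Im z = y + tau * k%:~R by rewrite /y subrK.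
have /andP[y0 y1] : 0 < y < tau.
  case/andP: rk; rewrite /y le_eqVlt => /orP[/eqP h|h1].
    by exfalso; apply: nl; exists k.
  rewrite le_eqVlt => /orP[/eqP h|]; first by exfalso; apply: nl; exists (k + 1).
  by rewrite intrD mulrDr mulr1 => h2; apply/andP; split; lra.
have sy : sin y <= y by apply: sin_le_id; exact: ltW.
have sy' : - sin y <= tau - y.
  have <- : sin (tau - y) = - sin y.
    by rewrite -sinN -(sinD_tauM (- y) 1) mulr1 addrC.
  by apply: sin_le_id; lra.
have e0 := expR_gt0 (Re z).
have kE : tau * (k + 1)%:~R = tau * k%:~R + tau by rewrite intrD mulrDr mulr1.
rewrite Im_dyn_map kE {1 2}yE sinD_tauM.
clearbody y.
have h1 : expR (Re z) * sin y <= expR (Re z) * y by rewrite ler_pM2l.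
have h2 : expR (Re z) * - sin y <= expR (Re z) * (tau - y) by rewrite ler_pM2l.
have h3 : expR (Re z) * y < y by rewrite gtr_pMl.
have h4 : expR (Re z) * (tau - y) < tau - y by rewrite gtr_pMl // subr_gt0.
by apply/andP; split; [|rewrite yE sinD_tauM]; lra.
Qed.

End Rows.

(** * Nested rectangles *)

Section Regions.
Variable R : realType.
Local Notation C := (R[i]^o).
Local Notation Re := complex.Re.
Local Notation Im := complex.Im.
Local Notation f := (@dyn_map R).
Local Notation tau := (@tau R).

(** Sides are counted in multiples of [tau], so that the horizontal sides of all boxes lie on the
    invariant family of lines. *)
Fixpoint half_width (n : nat) : nat :=
  if n is m.+1 then (Num.truncn (expR (tau * (half_width m)%:R))).+1 else 2.

Definition side (n : nat) : R := tau * (half_width n)%:R.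

(** The lower bound keeps the image of a square inside the next one. The upper bound lets
    [expR (2 * side n)], the square of [expR (side n)], throw points out of the next rectangle. *)
Lemma side_step n : 4 * expR (side n) <= side n.+1 <= 8 * (expR (side n) + 1).
Proof.
have /andP[t1 t2] := Num.Theory.truncn_itv (ltW (expR_gt0 (side n))).
have e0 := expR_gt0 (side n).
have t4 := tau_ge4 R; have t8 := tau_lt8 R.
rewrite {2 3}/side /= -/(side n).
set k := Num.truncn _ in t1 t2 *.
rewrite -natr1 in t2 *; have k0 : 0 <= k%:R :> R by exact: ler0n.
by apply/andP; split; nra.
Qed.

Lemma side_ge8 n : 8 <= side n.
Proof.
elim: n => [|n IH]; first by rewrite /side /=; have := tau_ge4 R; lra.
have /andP[h _] := side_step n; have := expR_ge1Dx (side n); lra.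
Qed.

Lemma expR_side n : 33 <= expR (side n) /\ 1 + side n <= expR (side n).
Proof.
have s8 := side_ge8 n; split; last exact: expR_ge1Dx.
have s0 : 0 <= side n by lra.
have := expR_ge_sqr s0; nra.
Qed.

Lemma side_double n : 4 * side n + 4 <= side n.+1.
Proof. have /andP[h _] := side_step n; have [_] := expR_side n; lra. Qed.

Lemma side_ge_nat n : n%:R <= side n.
Proof.
elim: n => [|n IH]; first by have := side_ge8 0; lra.
rewrite -natr1; have := side_double n; have := side_ge8 n; lra.
Qed.

Lemma side_ge_sqrt n : Num.sqrt 2 ^+ n <= side n.
Proof.
elim: n => [|n IH]; first by rewrite expr0; have := side_ge8 0; lra.
rewrite exprS; have := side_double n; have := side_ge8 n.
have q2 : Num.sqrt 2 <= 2 :> R.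
  by rewrite -[leRHS]ger0_norm // -sqrtr_sqr ler_wsqrtr //; lra.
have := sqrtr_ge0 (2 : R); have : 0 <= Num.sqrt 2 ^+ n :> R by rewrite exprn_ge0 // sqrtr_ge0.
nra.
Qed.

(** The margin 1 leaves room for the deformation on the next level, which fixes all points with real
    part at most [side n.+1 - 1]. *)
Lemma dyn_map_box n (z : C) : box (- side n) (side n) (- side n) (side n) z ->
  `|Re (f z)| < side n.+1 - 1 /\ `|Im (f z)| < side n.+1 - 1.
Proof.
move=> [/andP[x1 x2] /andP[y1 y2]].
have /andP[h _] := side_step n; have [e33 e1s] := expR_side n.
have eE : expR (Re z) <= expR (side n) by rewrite ler_expR.
have e0 := expR_gt0 (Re z).
have /andP[l0 l1] := ln2_bounds R.
have := cos_le1 (Im z); have := cos_geN1 (Im z).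
have := sin_le1 (Im z); have := sin_geN1 (Im z).
rewrite Re_dyn_map Im_dyn_map !ltr_norml => s1 s2 c1 c2.
have ec1 : expR (Re z) * cos (Im z) <= expR (Re z) by nra.
have ec2 : - expR (Re z) <= expR (Re z) * cos (Im z) by nra.
have es1 : expR (Re z) * sin (Im z) <= expR (Re z) by nra.
have es2 : - expR (Re z) <= expR (Re z) * sin (Im z) by nra.
by split; apply/andP; split; lra.
Qed.

Lemma dyn_map_left (z : C) : Re z <= 0 -> Re (f z) <= 2 * Re z + 3.
Proof.
move=> x0; rewrite Re_dyn_map; have e1 : expR (Re z) <= 1 by rewrite expR_le1.
have := cos_geN1 (Im z); have := expR_gt0 (Re z); have /andP[l0 l1] := ln2_bounds R.
nra.
Qed.

(** The exponential term dominates, since [|cos y| + |sin y| >= 1]. The bound [3 * side n.+1] is the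
    largest value of [|Re w| + |Im w|] on [crect n.+1]. *)
Lemma dyn_map_right n (z : C) : 2 * side n <= Re z -> `|Im z| <= side n ->
  3 * side n.+1 < `|Re (f z)| + `|Im (f z)|.
Proof.
move=> xs; rewrite ler_norml => /andP[y1 y2].
have /andP[_ h] := side_step n; have [e33 e1s] := expR_side n.
have s8 := side_ge8 n.
have /andP[l0 l1] := ln2_bounds R.
have E2 : expR (2 * side n) = expR (side n) * expR (side n).
  by rewrite -expRD mulr_natl mulr2n.
have eE : expR (2 * side n) - 2 * (2 * side n) <= expR (Re z) - 2 * Re z.
  have p1 : ln 2 <= 2 * side n by lra.
  move: xs; rewrite le_eqVlt => /orP[/eqP->//|xs].
  by have := phi_lt p1 xs; rewrite /phi; lra.
have cs : 1 <= `|cos (Im z)| + `|sin (Im z)|.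
  have := cos2Dsin2 (Im z); rewrite -(real_normK (num_real (cos _))).
  rewrite -(real_normK (num_real (sin _))).
  have := normr_ge0 (cos (Im z)); have := normr_ge0 (sin (Im z)); nra.
have e0 := expR_gt0 (Re z).
have a1 : expR (Re z) * `|cos (Im z)| - (2 * Re z + 2) <= `|Re (f z)|.
  rewrite Re_dyn_map -[X in X * `|_|](gtr0_norm e0) -normrM.
  set u := _ * cos _; have := lerB_dist u (2 * Re z + (2 - ln 2)).
  have p0 : 0 <= 2 * Re z + (2 - ln 2) by lra.
  by rewrite distrC (ger0_norm p0); lra.
have a2 : expR (Re z) * `|sin (Im z)| - 2 * side n <= `|Im (f z)|.
  rewrite Im_dyn_map -[X in X * `|_|](gtr0_norm e0) -normrM.
  set u := _ * sin _; have := lerB_dist u (2 * Im z).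
  have : `|2 * Im z| <= 2 * side n by rewrite ler_norml; apply/andP; split; lra.
  by rewrite distrC; lra.
have a3 : expR (Re z) <= expR (Re z) * (`|cos (Im z)| + `|sin (Im z)|).
  by rewrite ler_peMr // ltW.
have E31 : 31 * expR (side n) <= expR (side n) * expR (side n) - 2 * expR (side n).
  by nra.
rewrite mulrDr in a3; lra.
Qed.

Definition square n : set C :=
  [set z | - side n < Re z < side n /\ - side n < Im z < side n].
Definition csquare n := box (- side n) (side n) (- side n) (side n).
Definition rect n : set C :=
  [set z | - side n < Re z < 2 * side n /\ - side n < Im z < side n].
Definition crect n := box (- side n) (2 * side n) (- side n) (side n).

Fixpoint inner (j n : nat) : set C :=
  if j is i.+1 then rect n `&` f @^-1` inner i n.+1 else square n.
Fixpoint outer (j n : nat) : set C :=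
  if j is i.+1 then crect n `&` f @^-1` outer i n.+1 else crect n.

Lemma square_csquare n : square n `<=` csquare n.
Proof. by move=> z [/andP[a b] /andP[c d]]; split; rewrite !ltW. Qed.

Lemma csquare_crect n : csquare n `<=` crect n.
Proof.
move=> z [/andP[a b] h]; split=> //; rewrite a /=.
by have := side_ge8 n; lra.
Qed.

Lemma square_rect n : square n `<=` rect n.
Proof.
move=> z [/andP[a b] h]; split=> //; rewrite a /=.
by have := side_ge8 n; lra.
Qed.

Lemma rect_crect n : rect n `<=` crect n.
Proof. by move=> z [/andP[a b] /andP[c d]]; split; rewrite !ltW. Qed.

Lemma dyn_map_square n z : csquare n z -> square n.+1 (f z).
Proof.
move=> /dyn_map_box; rewrite !ltr_norml => -[/andP[a b] /andP[c d]].
by split; apply/andP; split; lra.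
Qed.

Lemma inner_rect j n : inner j n `<=` rect n.
Proof. by case: j => [|j]; [exact: square_rect|move=> z []]. Qed.

Lemma outer_crect j n : outer j n `<=` crect n.
Proof. by case: j => [//|j z []]. Qed.

Lemma open_itvRe (a b : R) : open [set z : C | a < Re z < b].
Proof.
rewrite (_ : [set _ | _] = (@complex.Re R : C -> R) @^-1` `]a, b[).
  by apply: open_comp; [move=> z _; exact: continuous_Re|exact: interval_open].
by apply/seteqP; split=> z /=; rewrite in_itv.
Qed.

Lemma open_itvIm (a b : R) : open [set z : C | a < Im z < b].
Proof.
rewrite (_ : [set _ | _] = (@complex.Im R : C -> R) @^-1` `]a, b[).
  by apply: open_comp; [move=> z _; exact: continuous_Im|exact: interval_open].
by apply/seteqP; split=> z /=; rewrite in_itv.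
Qed.

Lemma open_square n : open (square n).
Proof. by apply: openI; [exact: open_itvRe|exact: open_itvIm]. Qed.

Lemma open_rect n : open (rect n).
Proof. by apply: openI; [exact: open_itvRe|exact: open_itvIm]. Qed.

Lemma compact_crect n : compact (crect n).
Proof. exact: compact_box. Qed.

Lemma closed_crect n : closed (crect n).
Proof. exact: compact_closed (@hausdorffC R) (@compact_crect n). Qed.

Lemma open_inner j n : open (inner j n).
Proof.
elim: j n => [|j IH] n; first exact: open_square.
apply: openI; first exact: open_rect.
by apply: open_comp (IH _) => z _; exact: continuous_dyn_map.
Qed.

Lemma closed_outer j n : closed (outer j n).
Proof.
elim: j n => [|j IH] n; first exact: closed_crect.
apply: closedI; first exact: closed_crect.
by apply: closed_comp (IH _) => z _; exact: continuous_dyn_map.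
Qed.

Lemma innerS j n : inner j n `<=` inner j.+1 n.
Proof.
elim: j n => [|j IH] n z /=.
  by move=> h; split; [exact: square_rect|apply: dyn_map_square; exact: square_csquare].
by case=> h1 h2; split=> //; exact: (IH n.+1 (f z)).
Qed.

Lemma inner_le i j n : (i <= j)%N -> inner i n `<=` inner j n.
Proof.
elim: j => [|j IH]; first by rewrite leqn0 => /eqP->.
rewrite leq_eqVlt => /predU1P[->//|]; rewrite ltnS => /IH h.
by apply: subset_trans h _; exact: innerS.
Qed.

Lemma outerS j n : outer j.+1 n `<=` outer j n.
Proof.
elim: j n => [|j IH] n z; first by case.
by case=> h1 h2; split=> //; exact: (IH n.+1 (f z)).
Qed.

Lemma outer_le i j n : (i <= j)%N -> outer j n `<=` outer i n.
Proof.
elim: j => [|j IH]; first by rewrite leqn0 => /eqP->.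
rewrite leq_eqVlt => /predU1P[->//|]; rewrite ltnS => /IH h.
by apply: subset_trans h; exact: outerS.
Qed.

Lemma inner_outer i j n : inner i n `<=` outer j n.
Proof.
have d k m : inner k m `<=` outer k m.
  elim: k m => [|k IH] m z.
    by move=> h; apply: rect_crect; exact: square_rect.
  by case=> h1 h2; split; [exact: rect_crect|exact: IH].
move=> z h; have [ij|ji] := leqP i j; first exact: d (inner_le ij h).
exact: outer_le (ltnW ji) _ (d _ _ _ h).
Qed.

Lemma csquare_outer j n : csquare n `<=` outer j n.
Proof.
case: j => [|j] z h; first exact: csquare_crect.
split; first exact: csquare_crect.
by apply: (@inner_outer 0); exact: dyn_map_square.
Qed.

(** In particular no [outer j.+1 n] reaches the right side [Re z = 2 * side n], so that side
    contributes nothing to the boundary of the domain. *)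
Lemma crect_Re_lt n z : `|Im z| <= side n -> crect n.+1 (f z) ->
  Re z < 2 * side n.
Proof.
move=> y [/andP[a b] /andP[c d]]; rewrite ltNge; apply/negP => h.
have := dyn_map_right h y; have s8 := side_ge8 n.+1.
have : `|Re (f z)| <= 2 * side n.+1 by rewrite ler_norml; apply/andP; split; lra.
have : `|Im (f z)| <= side n.+1 by rewrite ler_norml c d.
lra.
Qed.

Lemma strip_floor (z : C) : exists k : int,
  strip k z /\ tau * k%:~R <= Im z < tau * (k + 1)%:~R.
Proof.
have t4 := tau_ge4 R; have t0 : 0 < tau by lra.
exists (Num.floor (Im z / tau)).
have /andP[a b] := Num.Theory.floor_itv (Im z / tau).
have {}a : tau * (Num.floor (Im z / tau))%:~R <= Im z by rewrite mulrC -ler_pdivlMr.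
have {}b : Im z < tau * (Num.floor (Im z / tau) + 1)%:~R by rewrite mulrC -ltr_pdivrMr.
by rewrite /strip a b (ltW b).
Qed.

End Regions.

(** * Connectedness of the rims *)

Section Rim.
Variable R : realType.
Local Notation C := (R[i]^o).
Local Notation Re := complex.Re.
Local Notation Im := complex.Im.
Local Notation f := (@dyn_map R).
Local Notation tau := (@tau R).
Local Notation side := (@side R).
Local Notation half_width := (@half_width R).

Lemma strip_floor_range n (z : C) : - side n < Im z < side n ->
  exists k : int, strip k z /\ - (half_width n)%:Z <= k < (half_width n)%:Z.
Proof.
have t4 := tau_ge4 R; have t0 : 0 < tau by lra.
move=> /andP[y1 y2]; have [k [zk /andP[k1 k2]]] := strip_floor z.
have sE : side n = tau * (half_width n)%:Z%:~R by rewrite /side pmulrn.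
exists k; split=> //; apply/andP; split.
  by rewrite -ltzD1 -(ltr_int R) -(ltr_pM2l t0) mulrNz mulrN -sE; lra.
by rewrite -(ltr_int R) -(ltr_pM2l t0) -sE; lra.
Qed.

(** Removing this open set deletes the left side of [crect n] but keeps its two corners, at which
    other pieces are attached. *)
Definition left_slab n : set C :=
  [set z | Re z < side n /\ - side n < Im z < side n].
Definition rim j n : set C := outer j n `\` (inner j n `|` left_slab n).

Lemma open_left_slab n : open (left_slab n).
Proof.
apply: openI; last exact: open_itvIm.
rewrite (_ : (fun _ => _) = (@complex.Re R : C -> R) @^-1` `]-oo, side n[).
  by apply: open_comp; [move=> z _; exact: continuous_Re|exact: interval_open].
by apply/seteqP; split=> z /=; rewrite in_itv.
Qed.

Lemma compact_rim j n : compact (rim j n).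
Proof.
rewrite /rim setDE; apply: compact_closedI.
  by apply: (subclosed_compact (@closed_outer R j n) (@compact_crect R n)); exact: outer_crect.
apply: open_closedC; apply: openU; [exact: open_inner|exact: open_left_slab].
Qed.

Lemma rimS j n : rim j.+1 n `<=` rim j n.
Proof.
move=> z [h1 h2]; split; first exact: outerS.
by move=> [h|h]; apply: h2; [left; exact: innerS|right].
Qed.

Lemma rim_square j n z : rim j n z -> ~ square n z.
Proof. by move=> [_ h] hs; apply: h; left; apply: (inner_le (leq0n j)). Qed.

Lemma rim_csquare j n z : csquare n z -> ~ rect n z -> ~ left_slab n z -> rim j n z.
Proof.
move=> h1 h2 h3; split; first exact: csquare_outer.
by move=> [/inner_rect|].
Qed.

(** For a height [y <= pi] above the lower line, [y * cos y <= sin y] gives [2 y <= expR x * sin y];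
    the upper half follows by reflection. This applies to points whose image lies on the left side
    of the next rectangle. *)
Lemma strip_right_image k (z : C) : strip k z -> 2 <= expR (Re z) * cos (Im z) ->
  Im (f z) <= 2 * (tau * k%:~R) \/ 2 * (tau * (k + 1)%:~R) <= Im (f z).
Proof.
have kE : tau * (k + 1)%:~R = tau * k%:~R + tau by rewrite intrD mulrDr mulr1.
rewrite /strip Im_dyn_map kE.
pose y := Im z - tau * k%:~R.
have -> : Im z = y + tau * k%:~R by rewrite /y subrK.
rewrite cosD_tauM sinD_tauM; clearbody y => /andP[y0 yt] h.
have e0 := expR_gt0 (Re z).
have [yp|yp] := leP y pi.
  left; have : y * cos y <= sin y by apply: mul_cos_le_sin; apply/andP; split; lra.
  rewrite -(ler_pM2l e0); have y0' : 0 <= y by lra.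
  by have := ler_wpM2l y0' h; lra.
right; have tE := tauE R.
have y1 : 0 <= tau - y by lra.
have : (tau - y) * cos (tau - y) <= sin (tau - y).
  by apply: mul_cos_le_sin; apply/andP; split; lra.
have -> : tau - y = - y + tau * 1%:~R by rewrite mulr1 addrC.
rewrite cosD_tauM sinD_tauM cosN sinN mulr1 -(ler_pM2l e0).
by have := ler_wpM2l y1 h; lra.
Qed.

Lemma rim_connected_base n : connected (rim 0 n).
Proof.
have s8 := side_ge8 R n.
have -> : rim 0 n = box (- side n) (2 * side n) (side n) (side n) `|`
    box (side n) (2 * side n) (- side n) (side n) `|`
    box (- side n) (2 * side n) (- side n) (- side n).
  apply/seteqP; split=> z.
    move=> [[/andP[x1 x2] /andP[y1 y2]] h].
    have nsl : ~ left_slab n z by move=> hl; apply: h; right.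
    have [yE|yn] := eqVneq (Im z) (side n).
      by left; left; split; rewrite ?x1 ?x2 // yE lexx.
    have [yE|ym] := eqVneq (Im z) (- side n).
      by right; split; rewrite ?x1 ?x2 // yE lexx.
    left; right; split; last by rewrite y1 y2.
    rewrite x2 andbT leNgt; apply/negP => xs; apply: nsl; split=> //.
    by rewrite !lt_neqAle eq_sym ym yn y1 y2.
  have key w : crect n w -> Im w = side n \/ Im w = - side n \/ side n <= Re w ->
      rim 0 n w.
    move=> hw h; split=> // -[[/andP[_ x2] /andP[y1 y2]]|[x2 /andP[y1 y2]]];
      by case: h => [h|[h|h]]; lra.
  move=> [[|]|] [/andP[x1 x2] /andP[y1 y2]]; apply: key.
  - by split; apply/andP; split; lra.
  - by left; lra.
  - by split; apply/andP; split; lra.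
  - by right; right.
  - by split; apply/andP; split; lra.
  - by right; left; lra.
apply: connectedU; last exact: connected_box.
  exists (side n +i* - side n); split; last by split=> /=; apply/andP; split; lra.
  by right; split=> /=; apply/andP; split; lra.
apply: connectedU; [|exact: connected_box|exact: connected_box].
by exists (side n +i* side n); split; split=> /=; apply/andP; split; lra.
Qed.

Definition rim_cut j n (k : int) : set C :=
  rim j n `|` box (- side n) (- side n) (2 * (tau * (k + 1)%:~R)) (side n)
          `|` box (- side n) (- side n) (- side n) (2 * (tau * k%:~R)).
(** For [k] in range this is a piece of [rim j.+1 n]: the index [j] refers to the rim containing the
    images. *)
Definition rim_strip j n (k : int) : set C :=
  box (side n) (2 * side n) (tau * k%:~R) (tau * (k + 1)%:~R)
  `&` f @^-1` rim_cut j n.+1 k.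

Lemma strip_range n (k : int) : - (half_width n)%:Z <= k < (half_width n)%:Z ->
  - side n <= tau * k%:~R /\ tau * (k + 1)%:~R <= side n.
Proof.
have t4 := tau_ge4 R; have t0 : 0 < tau by lra.
move=> /andP[h1 h2]; rewrite /side.
have -> : (half_width n)%:R = ((half_width n)%:Z)%:~R :> R by rewrite pmulrn.
rewrite -mulrN -mulrNz !ler_pM2l // !ler_int; split=> //.
by rewrite lezD1.
Qed.

Lemma crect_rim_cut j n k w : (- (side n) <= 2 * (tau * k%:~R)) ->
  2 * (tau * (k + 1)%:~R) <= side n -> rim_cut j n k w ->
  [/\ outer j n w, ~ inner j n w & ~ square n w].
Proof.
move=> k1 k2; have s8 := side_ge8 R n.
have t4 := tau_ge4 R.
have kE : tau * (k + 1)%:~R = tau * k%:~R + tau by rewrite intrD mulrDr mulr1.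
have b w0 : Re w0 = - side n -> - side n <= Im w0 <= side n ->
    [/\ outer j n w0, ~ inner j n w0 & ~ square n w0].
  move=> xw yw; split.
  - by apply: csquare_outer; split=> //; rewrite xw lexx; lra.
  - by move=> /inner_rect[/andP[]]; rewrite xw ltxx.
  - by move=> [/andP[]]; rewrite xw ltxx.
move=> [[h|[/andP[x1 x2] /andP[y1 y2]]]|[/andP[x1 x2] /andP[y1 y2]]].
- have h' := rim_square h; case: h => h1 h2; split=> // h3; apply: h2; by left.
- by apply: b; [lra|apply/andP; split; lra].
- by apply: b; [lra|apply/andP; split; lra].
Qed.

Lemma connected_rim_cut j n k : (- (side n) <= 2 * (tau * k%:~R)) ->
  2 * (tau * (k + 1)%:~R) <= side n -> connected (rim j n) ->
  connected (rim_cut j n k).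
Proof.
move=> k1 k2 cr; have s8 := side_ge8 R n.
have corner y : y = side n \/ y = - side n -> rim j n (- side n +i* y).
  move=> h; apply: rim_csquare.
  - by split=> /=; apply/andP; split; case: h => h; lra.
  - by move=> [/andP[/= h1 _] _]; rewrite ltxx in h1.
  - by move=> [_ /= /andP[h1 h2]]; case: h => h; lra.
apply: connectedU; last exact: connected_box.
  exists (- side n +i* - side n); split; first by left; apply: corner; right.
  by split=> /=; apply/andP; split; lra.
apply: connectedU => //; last exact: connected_box.
exists (- side n +i* side n); split; first by apply: corner; left.
by split=> /=; apply/andP; split; lra.
Qed.

Lemma compact_rim_cut j n k : compact (rim_cut j n k).
Proof. by apply: compactU; [apply: compactU|]; [exact: compact_rim|exact: compact_box..]. Qed.

Lemma connected_rim_strip j n k : - (half_width n)%:Z <= k < (half_width n)%:Z ->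
  connected (rim j n.+1) -> connected (rim_strip j n k).
Proof.
move=> /strip_range[k1 k2] cr; have sd := side_double R n; have s8 := side_ge8 R n.
have k1' : - side n.+1 <= 2 * (tau * k%:~R) by lra.
have k2' : 2 * (tau * (k + 1)%:~R) <= side n.+1 by lra.
have /andP[l0 l1] := ln2_bounds R.
apply: (@connected_inj_preimage _ _ _ (f : C -> C)).
- exact: hausdorffC.
- apply: compact_closedI; first exact: compact_box.
  have cX := compact_closed (@hausdorffC R) (@compact_rim_cut j n.+1 k).
  by apply: closed_comp cX => z _; exact: continuous_dyn_map.
- exact: continuous_dyn_map.
- move=> z1 z2; rewrite !inE => -[[/andP[a _] b] _] [[/andP[c _] d] _] fE.
  by apply: (strip_inj_right b d fE); lra.
suff -> : f @` rim_strip j n k = rim_cut j n.+1 k by exact: connected_rim_cut.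
apply/seteqP; split=> [_ [z [_ h] <-] //|w hw].
have [ow iw sw] := crect_rim_cut k1' k2' hw.
have [z [zk zw zb]] := dyn_map_surj_strip k w.
exists z => //; split; last by rewrite /preimage /= zw.
have zs : `|Im z| <= side n.
  by case/andP: zk => a b; rewrite ler_norml; apply/andP; split; lra.
have xN : Re z < 2 * side n.
  by apply: crect_Re_lt zs _; rewrite zw; exact: outer_crect ow.
(* If [Re z < side n], then either [z] is in [csquare n] and [w] in a square, or [Re z < - side n];
   in that case [w] is in [left_slab n.+1], at a height strictly between the two added pieces. *)
split=> //; rewrite (ltW xN) andbT leNgt; apply/negP => xs.
have [xl|xl] := leP (- side n) (Re z).
  apply: sw; rewrite -zw; apply: dyn_map_square.
  by split; [rewrite xl ltW|rewrite -ler_norml].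
have nl : ~ (exists l : int, Im z = tau * l%:~R) by move=> /zb; lra.
have x0 : Re z < 0 by lra.
have := strip_left_image zk nl x0; rewrite zw => /andP[i1 i2].
have := dyn_map_left (ltW x0); rewrite zw => r1.
case: hw => [[[_ h]|[_ /andP[? ?]]]|[_ /andP[? ?]]]; try lra.
apply: h; right; split; first lra.
by apply/andP; split; lra.
Qed.

(* [q + 2 pi i k] is the point where consecutive [rim_strip]s are glued. *)
Lemma cut_point n : exists2 q, side n < q < 2 * side n & phi q = - side n.+1.
Proof.
have s8 := side_ge8 R n; have s8' := side_ge8 R n.+1.
have /andP[l0 l1] := ln2_bounds R.
have [|q q2 qE] := @phi_surj R (- side n.+1); first by lra.
have Im0 : Im (q +i* 0) = tau * 0%:~R by rewrite mulr0.
have fq := dyn_map_line Im0; rewrite /= qE !mulr0 in fq.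
exists q => //; apply/andP; split.
  rewrite ltNge; apply/negP => qs.
  have : square n.+1 (f (q +i* 0)).
    by apply: dyn_map_square; split=> /=; apply/andP; split; lra.
  by rewrite fq => -[/andP[]] /=; rewrite ltxx.
apply: (@crect_Re_lt R n (q +i* 0)); first by rewrite /= normr0; lra.
by rewrite fq; split=> /=; apply/andP; split; lra.
Qed.

Lemma rim_strip_cut_point j n k l q : - (half_width n)%:Z <= k < (half_width n)%:Z ->
  side n < q < 2 * side n -> phi q = - side n.+1 -> l = k \/ l = k + 1 ->
  rim_strip j n k (q +i* (tau * l%:~R)).
Proof.
move=> /strip_range[k1 k2] /andP[q1 q2] qE lk.
have sd := side_double R n; have s8 := side_ge8 R n; have t4 := tau_ge4 R.
have kE : tau * (k + 1)%:~R = tau * k%:~R + tau by rewrite intrD mulrDr mulr1.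
have lE : tau * l%:~R = tau * k%:~R \/ tau * l%:~R = tau * k%:~R + tau.
  by case: lk => ->; [left|right].
split; first by split=> /=; apply/andP; split; case: lE => lE; lra.
rewrite /preimage /= (@dyn_map_line R _ l) //= qE.
case: lE => lE; [right|left; right]; split=> /=; apply/andP; split; lra.
Qed.

Lemma int_offset (a : nat) (k : int) : - a%:Z <= k < a%:Z ->
  exists2 i : nat, (i < a + a)%N & k = - a%:Z + i%:Z.
Proof. by move=> ka; exists (absz (k + a%:Z)); lia. Qed.

(** The strips are chained from bottom to top through the gluing points [p i], starting at the lower
    horizontal side; the upper side is attached at the end. *)
Lemma rim_connected_step j n : connected (rim j n.+1) -> connected (rim j.+1 n).
Proof.
move=> cr; have [q qs qE] := cut_point n.
have /andP[q1 q2] := qs.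
have sd := side_double R n; have s8 := side_ge8 R n; have t4 := tau_ge4 R.
have t0 : 0 < tau by lra.
have /andP[l0 l1] := ln2_bounds R.
have [a aE] : exists a, half_width n = a by exists (half_width n).
(* The horizontal sides end at [q]: beyond it [phi] is below [- side n.+1], so that the image leaves
   [crect n.+1]. *)
pose edge (y : R) := box (- side n) q y y.
pose Y i := rim_strip j n (- a%:Z + i%:Z).
pose p i : C := q +i* (tau * (- a%:Z + i%:Z)%:~R).
have kr i : (i < a + a)%N ->
    - (half_width n)%:Z <= - a%:Z + i%:Z < (half_width n)%:Z by rewrite aE => ia; lia.
have pa : p (a + a)%N = q +i* side n.
  by apply: complex_ext => //=; rewrite PoszD addKr /side aE pmulrn.
have p0 : p 0%N = q +i* - side n.
  by apply: complex_ext => //=; rewrite addr0 mulrNz mulrN /side aE pmulrn.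
have YP i : (i < a + a)%N -> [/\ connected (Y i), Y i (p i) & Y i (p i.+1)].
  move=> /kr ia; split; first exact: connected_rim_strip.
  - by apply: rim_strip_cut_point => //; left.
  - by apply: rim_strip_cut_point => //; right; lia.
have ep : edge (- side n) (p 0%N).
  by rewrite p0; split=> /=; apply/andP; split; lra.
have [cU Up] := connected_chain YP (@connected_box R _ _ _ _ : connected (edge (- side n))) ep.
suff -> : rim j.+1 n =
    (edge (- side n) `|` \bigcup_(i in `I_(a + a)) Y i) `|` edge (side n).
  apply: connectedU => //; last exact: connected_box.
  exists (p (a + a)%N); split=> //.
  by rewrite pa; split=> /=; apply/andP; split; lra.
have sE : side n = tau * (a%:Z)%:~R by rewrite /side aE pmulrn.
have sE' : - side n = tau * (- a%:Z)%:~R by rewrite mulrNz mulrN -sE.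
apply/seteqP; split=> z.
  move=> [[zc fo] h]; have [/andP[x1 x2] /andP[y1 y2]] := zc.
  have fc := outer_crect fo; have [/andP[u1 u2] /andP[v1 v2]] := fc.
  have nsl : ~ left_slab n z by move=> hl; apply: h; right.
  have ed l : Im z = tau * l%:~R -> edge (tau * l%:~R) z.
    move=> zl; split; last by rewrite zl lexx.
    rewrite x1 leNgt; apply/negP => qz.
    have q2' : ln 2 <= q by lra.
    by have := phi_lt q2' qz; move: u1; rewrite (dyn_map_line zl) /= qE; lra.
  have [yE|yn] := eqVneq (Im z) (side n).
    by right; rewrite sE; apply: ed; rewrite -sE.
  have [yE|ym] := eqVneq (Im z) (- side n).
    by left; left; rewrite sE'; apply: ed; rewrite -sE'.
  have {}y1 : - side n < Im z by rewrite lt_neqAle eq_sym ym y1.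
  have {}y2 : Im z < side n by rewrite lt_neqAle yn y2.
  have xs : side n <= Re z.
    by rewrite leNgt; apply/negP => xs; apply: nsl; split=> //; apply/andP; split.
  have xN : Re z < 2 * side n.
    by apply: crect_Re_lt fc; rewrite ler_norml; apply/andP; split; lra.
  have ni : ~ inner j n.+1 (f z).
    move=> hi; apply: h; left; split=> //.
    by split; rewrite ?y1 ?y2 // xN andbT; lra.
  left; right; have zIm : - side n < Im z < side n by rewrite y1 y2.
  have [k [zk ka]] := strip_floor_range zIm; rewrite aE in ka.
  have [i ia kE] := int_offset ka.
  exists i; first exact: ia.
  rewrite /Y -kE; split; first by split; [rewrite xs ltW|exact: zk].
  rewrite /preimage /=.
  have [hs|hs] := pselect (left_slab n.+1 (f z)); last by left; left; split=> // -[].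
  (* The image is in the slab but not in [square n.+1], hence on the left side of [crect n.+1], and
     [strip_right_image] places it in one of the added pieces. *)
  have [u3 /andP[v3 v4]] := hs.
  have uE : Re (f z) = - side n.+1.
    apply/eqP; rewrite eq_le u1 andbT leNgt; apply/negP => u4; apply: ni.
    by apply: (inner_le (leq0n j)); split; apply/andP; split.
  have ec : 2 <= expR (Re z) * cos (Im z) by move: uE; rewrite Re_dyn_map; lra.
  have [vE|vE] := strip_right_image zk ec.
    by right; split; rewrite ?uE ?lexx // v1.
  by left; right; split; rewrite ?uE ?lexx // vE.
have edge_rim l : tau * l%:~R = side n \/ tau * l%:~R = - side n ->
    edge (tau * l%:~R) `<=` rim j.+1 n.
  move=> lE w [/andP[x1 x2] yE].
  have {}yE : Im w = tau * l%:~R by apply/eqP; rewrite eq_le andbC.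
  split; last first.
    move=> [[[_ /andP[y1 y2]] _]|[_ /andP[y1 y2]]].
      by rewrite yE in y1 y2; case: lE => lE; lra.
    by rewrite yE in y1 y2; case: lE => lE; lra.
  split; first by split; apply/andP; split; rewrite ?yE; case: lE => lE; lra.
  apply: csquare_outer; rewrite (dyn_map_line yE).
  have p2 := phi_le_ln2 (Re w).
  have p1 : - side n.+1 <= phi (Re w).
    have [w2|w2] := leP (ln 2) (Re w).
      move: x2; rewrite le_eqVlt => /orP[/eqP->|x2]; first by rewrite qE.
      by rewrite -qE ltW // phi_lt.
    have : expR (Re w) <= 2 by rewrite -[leRHS]lnK ?posrE // ler_expR ltW.
    by rewrite /phi; lra.
  by split=> /=; apply/andP; split; case: lE => lE; lra.
move=> [[|[i ia [[/andP[x1 x2] /andP[y1 y2]] hf]]]|].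
- by rewrite sE'; apply: edge_rim; right.
- have [k1 k2] := strip_range (kr _ ia).
  have [||ow iw _] := crect_rim_cut _ _ hf; [by lra..|].
  split; first by split=> //; split; apply/andP; split; lra.
  by move=> [[_ /iw]|[x3 _]] //; lra.
- by rewrite sE; apply: edge_rim; left.
Qed.

Lemma rim_connected j n : connected (rim j n).
Proof.
elim: j n => [|j IH] n; first exact: rim_connected_base.
exact: rim_connected_step.
Qed.

End Rim.

(** * Pushing the domains to the left *)

Section Homotopy.
Variable R : realType.
Local Notation C := (R[i]^o).
Local Notation Re := complex.Re.
Local Notation Im := complex.Im.
Local Notation f := (@dyn_map R).
Local Notation tau := (@tau R).
Local Notation side := (@side R).
Local Notation half_width := (@half_width R).

Lemma strip_uniq k l (z : C) : strip k z -> strip l z ->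
  ~ (exists m : int, Im z = tau * m%:~R) -> k = l.
Proof.
have t4 := tau_ge4 R; have t0 : 0 < tau by lra.
have st m : strip m z -> ~ (exists m : int, Im z = tau * m%:~R) ->
    tau * m%:~R < Im z < tau * (m + 1)%:~R.
  move=> /andP[a b] nl; rewrite !lt_neqAle a b !andbT; apply/andP.
  by split; apply/eqP => h; apply: nl; [exists m|exists (m + 1)].
move=> /st hk /st hl nl; move: (hk nl) (hl nl) => /andP[a b] /andP[c d].
have : tau * k%:~R < tau * (l + 1)%:~R by lra.
have : tau * l%:~R < tau * (k + 1)%:~R by lra.
rewrite !(ltr_pM2l t0) !ltr_int; lia.
Qed.

Lemma right_not_line (z : C) : ln 2 < Re (f z) ->
  ~ (exists m : int, Im z = tau * m%:~R).
Proof. by move=> h [m /dyn_map_line E]; move: h; rewrite E /= ltNge phi_le_ln2. Qed.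

(** The retraction of the line onto [[0, 1]], written with absolute values to make its continuity
    immediate. *)
Definition clamp (t : R) : R := (1 + `|t| - `|t - 1|) / 2.

Lemma clamp_le0 t : t <= 0 -> clamp t = 0.
Proof. by move=> t0; rewrite /clamp ler0_norm // ler0_norm; lra. Qed.

Lemma clamp_ge1 t : 1 <= t -> clamp t = 1.
Proof. by move=> t1; rewrite /clamp ger0_norm ?ger0_norm; lra. Qed.

Lemma clamp_id t : 0 <= t <= 1 -> clamp t = t.
Proof.
by move=> /andP[t0 t1]; rewrite /clamp ger0_norm // ler0_norm; lra.
Qed.

Lemma clamp_itv t : 0 <= clamp t <= 1.
Proof.
have [t0|t0] := leP t 0; first by rewrite clamp_le0 // lexx ler01.
have [t1|t1] := leP 1 t; first by rewrite clamp_ge1 // lexx ler01.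
by rewrite clamp_id; apply/andP; split; lra.
Qed.

Lemma continuous_clamp : continuous clamp.
Proof.
move=> t; apply: cvgM; last exact: cvg_cst.
have c1 : `|x| @[x --> t] --> `|t| by apply: cvg_norm; exact: cvg_id.
have c2 : `|x - 1| @[x --> t] --> `|t - 1|.
  by apply: cvg_norm; exact: cvgB cvg_id (cvg_cst _).
exact: cvgB (cvgD (cvg_cst _) c1) c2.
Qed.

Definition pos_part (x : R) := (x + `|x|) / 2.

Lemma pos_part_le0 x : x <= 0 -> pos_part x = 0.
Proof. by move=> x0; rewrite /pos_part ler0_norm //; lra. Qed.

Lemma pos_part_ge0 x : 0 <= x -> pos_part x = x.
Proof. by move=> x0; rewrite /pos_part ger0_norm //; lra. Qed.

Definition push (c : R) (p : R * C) : C :=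
  (Re p.2 - clamp p.1 * pos_part (Re p.2 - c)) +i* Im p.2.

Lemma continuous_push c : continuous (push c).
Proof.
suff H (p : R * C) : push c @ p --> (push c p : C) by move=> p; exact: H.
have cR : Re q.2 @[q --> p] --> Re p.2.
  by apply: (continuous_comp (@cvg_snd _ _ _ _ _) (@continuous_Re R p.2)).
have cI : Im q.2 @[q --> p] --> Im p.2.
  by apply: (continuous_comp (@cvg_snd _ _ _ _ _) (@continuous_Im R p.2)).
have cC : clamp q.1 @[q --> p] --> clamp p.1.
  apply: (@continuous_comp _ _ _ (fst : R * C -> R) clamp p); first exact: cvg_fst.
  exact: continuous_clamp.
apply: (cvgCP (F := nbhs p) (push c) (push c p)).2; split=> //=.
apply: cvgB => //; apply: cvgM => //.
have cB : Re q.2 - c @[q --> p] --> Re p.2 - c by exact: cvgB cR (cvg_cst _).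
exact: cvgM (cvgD cB (cvg_norm cB)) (cvg_cst _).
Qed.

Lemma push_le0 c t z : t <= 0 -> push c (t, z) = z.
Proof. by move=> t0; apply: complex_ext => //=; rewrite clamp_le0 // mul0r subr0. Qed.

Lemma push_left c t z : Re z <= c -> push c (t, z) = z.
Proof.
move=> zc; apply: complex_ext => //=.
by rewrite pos_part_le0 ?mulr0 ?subr0 // subr_le0.
Qed.

Lemma push_itv c t z : c <= Re z -> c <= Re (push c (t, z)) <= Re z.
Proof.
move=> zc /=; rewrite pos_part_ge0 ?subr_ge0 //.
have /andP[c0 c1] := clamp_itv t; apply/andP; split; nra.
Qed.

Lemma push_ge1 c t z : 1 <= t -> Re (push c (t, z)) <= c.
Proof.
move=> t1 /=; rewrite clamp_ge1 // mul1r.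
have [zc|zc] := leP (Re z) c; first by rewrite pos_part_le0; lra.
by rewrite pos_part_ge0; lra.
Qed.

(* [t] ranges over all of [R] so that continuity at the points of an open [X]
   needs no relative topology; only [0 <= t <= 1] matters. *)
Definition push_left_homotopy (X : set C) (c : R) (H : R * C -> C) :=
  [/\ forall t z, X z -> {for (t, z), continuous H},
      forall t z, X z -> X (H (t, z)),
      forall t z, X z -> t <= 0 -> H (t, z) = z &
  [/\ forall t z, X z -> 1 <= t -> Re (H (t, z)) <= c,
      forall t z, X z -> Re z <= c -> H (t, z) = z &
      forall t z, X z -> c <= Re z -> c <= Re (H (t, z))]].

Lemma square_push n : push_left_homotopy (square n) (side n - 1) (push (side n - 1)).
Proof.
split.
- by move=> t z _; exact: continuous_push.
- move=> t z hz; have [zc|zc] := leP (Re z) (side n - 1); first by rewrite push_left.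
  have s8 := side_ge8 R n.
  have /andP[] := push_itv t (ltW zc); case: hz => /andP[x1 x2] y12 h1 h2.
  by split=> //; apply/andP; split; lra.
- by move=> t z _; exact: push_le0.
split.
- by move=> t z _; exact: push_ge1.
- by move=> t z _; exact: push_left.
- by move=> t z _ /push_itv => /(_ t)/andP[].
Qed.

(** At fixed height [y], [Im (f z')] lies between [2 y] and [Im (f z)]. [Re (f z')] could be too
    small only if [expR (Re z') * cos y > 2], but then [Re f] decreases from [z'] to [z]. It is not
    too large because for [cos y < 0] it is at most [Re (f z)]. *)
Lemma push_preimage_square n (z z' : C) : rect n z -> rect n.+1 (f z) ->
  Re (f z) <= side n.+1 - 1 -> side n - 1 <= Re z' <= Re z -> Im z' = Im z ->
  square n.+1 (f z').
Proof.
move=> [/andP[x1 x2] /andP[y1 y2]] [/andP[u1 _] /andP[v1 v2]] u2 /andP[x1' x2'] yE.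
have sd := side_double R n; have s8 := side_ge8 R n.
have /andP[l0 l1] := ln2_bounds R.
move: u1 u2 v1 v2; rewrite !Re_dyn_map !Im_dyn_map => u1 u2 v1 v2.
have e0 := expR_gt0 (Re z'); have e1 : expR (Re z') <= expR (Re z) by rewrite ler_expR.
have eD : expR (Re z') * (1 + (Re z - Re z')) <= expR (Re z).
  have -> : expR (Re z) = expR (Re z') * expR (Re z - Re z').
    by rewrite -expRD addrC subrK.
  by rewrite ler_pM2l // expR_ge1Dx.
split; rewrite ?Re_dyn_map ?Im_dyn_map yE; apply/andP; split.
- have [c2|c2] := leP (expR (Re z') * cos (Im z)) 2; first lra.
  have c0 : 0 < cos (Im z) by rewrite -(pmulr_rgt0 _ e0); lra.
  have : expR (Re z') * (1 + (Re z - Re z')) * cos (Im z) <= expR (Re z) * cos (Im z).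
    by rewrite ler_pM2r.
  have : (Re z - Re z') * 2 <= (Re z - Re z') * (expR (Re z') * cos (Im z)).
    by apply: ler_wpM2l; lra.
  lra.
- have [c0|c0] := leP 0 (cos (Im z)).
    by have := mulr_ge0 (ltW e0) c0; lra.
  have : expR (Re z) * cos (Im z) <= expR (Re z') * cos (Im z) by rewrite ler_wnM2r // ltW.
  lra.
- have [c0|c0] := leP 0 (sin (Im z)).
    have : expR (Re z') * sin (Im z) <= expR (Re z) * sin (Im z) by rewrite ler_wpM2r.
    lra.
  have : expR (Re z') * sin (Im z) <= 0 by rewrite pmulr_rle0 // ltW.
  lra.
- have [c0|c0] := leP 0 (sin (Im z)).
    have : 0 <= expR (Re z') * sin (Im z) by rewrite pmulr_rge0.
    lra.
  have : expR (Re z) * sin (Im z) <= expR (Re z') * sin (Im z) by rewrite ler_wnM2r // ltW.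
  lra.
Qed.

Lemma ln2_lt_side n : ln 2 < side n - 1.
Proof. by have := side_ge8 R n; have /andP[l0 l1] := ln2_bounds R; lra. Qed.

(** * Lifting a deformation through the inverse branches *)

Section Lift.
Variables (j n : nat) (H : R * C -> C).
Hypothesis HP : push_left_homotopy (inner j n.+1) (side n.+1 - 1) H.

(** Where [H] fixes [f z], the point [z] is kept; elsewhere the lift is a preimage of [H (t, f z)]
    in the strip of [z]. The default value of [xget] does not occur on [inner j.+1 n]. *)
Definition lift_homotopy (p : R * C) : C :=
  if Re (f p.2) <= side n.+1 - 1 then p.2 else
  xget p.2 [set w : C | (exists k, strip k p.2 /\ strip k w) /\ f w = H (p.1, f p.2)].

Lemma dyn_map_lift t z : inner j.+1 n z ->
  f (lift_homotopy (t, z)) = H (t, f z) /\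
  (forall k, strip k z -> strip k (lift_homotopy (t, z))).
Proof.
have sl := ln2_lt_side n.+1.
move=> [_ zi]; rewrite /lift_homotopy /=; case: HP => _ _ _ [_ Hleft _].
case: ifPn => [zl|]; first by rewrite Hleft.
rewrite -ltNge => zr.
case: xgetP => [w wE [[k [zk wk]] fw]|nw].
  split=> // l zl; suff -> : l = k by [].
  by apply: strip_uniq zl zk _; apply: right_not_line; lra.
exfalso; have [k [zk _]] := strip_floor z.
have [w [wk fw _]] := dyn_map_surj_strip k (H (t, f z)).
by apply: (nw w); split=> //; exists k.
Qed.

(** The image of the lift stays at or to the right of [side n.+1 - 1], whereas [csquare n] and
    everything to its left are mapped left of that line. The lift remains in its strip and off the
    lines, hence between the horizontal sides. *)
Lemma lift_right t z : inner j.+1 n z -> side n.+1 - 1 < Re (f z) ->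
  [/\ rect n (lift_homotopy (t, z)), side n < Re (lift_homotopy (t, z)) &
     side n.+1 - 1 <= Re (f (lift_homotopy (t, z)))].
Proof.
have sl := ln2_lt_side n.+1.
move=> zi zr; have [fw wk] := dyn_map_lift t zi.
set w := lift_homotopy (t, z) in fw wk *.
have s8 := side_ge8 R n; have s8' := side_ge8 R n.+1.
case: HP => _ Hin _ [_ _ Hright].
have wr : side n.+1 - 1 <= Re (f w).
  by rewrite fw; apply: Hright; [case: zi|exact: ltW].
have wc : crect n.+1 (f w).
  by rewrite fw; apply: rect_crect; apply: inner_rect (Hin _ _ _); case: zi.
have zIm : - side n < Im z < side n by case: zi => -[].
have [k [/wk wk' /strip_range[k1 k2]]] := strip_floor_range zIm.
have nl : ~ (exists m : int, Im w = tau * m%:~R) by apply: right_not_line; lra.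
have sE : side n = tau * (half_width n)%:Z%:~R by rewrite /side pmulrn.
have w12 : - side n < Im w < side n.
  case/andP: (wk') => a b; rewrite !lt_neqAle; apply/andP; split; apply/andP; split; try lra.
    apply/eqP => h; apply: nl; exists (- (half_width n)%:Z).
    by rewrite mulrNz mulrN -sE.
  by apply/eqP => h; apply: nl; exists (half_width n)%:Z; rewrite -sE.
have wn : `|Im w| <= side n by rewrite ler_norml; apply/andP; split; lra.
have xN := crect_Re_lt wn wc.
have xs : side n < Re w.
  rewrite ltNge; apply/negP => xs.
  have [xl|xl] := leP (- side n) (Re w).
    have : csquare n w by split; [rewrite xl|rewrite -ler_norml].
    by move=> /dyn_map_box[]; rewrite ltr_norml => /andP[]; lra.
  have x0 : Re w <= 0 by lra.
  by have := dyn_map_left x0; lra.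
by split=> //; split=> //; apply/andP; split; lra.
Qed.

Lemma lift_inner t z : inner j.+1 n z -> inner j.+1 n (lift_homotopy (t, z)).
Proof.
move=> zi; have [fw wk] := dyn_map_lift t zi.
split; last by rewrite /preimage /= fw; case: HP => _ Hin _ _; apply: Hin; case: zi.
have [zl|zr] := leP (Re (f z)) (side n.+1 - 1).
  by rewrite /lift_homotopy /= zl; case: zi.
by have [] := lift_right t zi zr.
Qed.

Lemma lift_le0 t z : inner j.+1 n z -> t <= 0 -> lift_homotopy (t, z) = z.
Proof.
have sl := ln2_lt_side n.+1.
move=> zi t0; have [fw wk] := dyn_map_lift t zi.
have [zl|zr] := leP (Re (f z)) (side n.+1 - 1); first by rewrite /lift_homotopy /= zl.
have fE : f z = f (lift_homotopy (t, z)).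
  by rewrite fw; case: HP => _ _ Hid _; rewrite Hid //; case: zi.
have [k [zk _]] := strip_floor z.
by apply/esym; apply: (strip_inj_Re zk (wk _ zk) fE); lra.
Qed.

(** Where [Re (f z) < side n.+1 - 1] the lift is locally the projection. Otherwise, equality
    included, the lift is the only point of the compact piece [K] of the strip over its image, and
    nearby lifts lie in the same [K]. *)
Lemma continuous_lift t z : inner j.+1 n z -> {for (t, z), continuous lift_homotopy}.
Proof.
have sl := ln2_lt_side n.+1.
move=> zi; have [zr|zl] := leP (side n.+1 - 1) (Re (f z)); last first.
  have cf : {for (t, z), continuous (fun p : R * C => Re (f p.2))}.
    apply: (@continuous_comp _ _ _ (fun p : R * C => f p.2 : C) (@complex.Re R)).
      apply: (@continuous_comp _ _ _ (snd : R * C -> C) (f : C -> C)); first exact: cvg_snd.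
      exact: continuous_dyn_map.
    exact: continuous_Re.
  have near_l : \forall p \near (t, z), Re (f p.2) <= side n.+1 - 1.
    have h : \forall p \near (t, z), Re (f p.2) < side n.+1 - 1.
      exact: (cvgr_lt _ cf _ zl).
    by apply: filterS h => p /ltW.
  have e : lift_homotopy (t, z) = z by rewrite /lift_homotopy /= ltW.
  apply: (eq_ind_r (fun y : C => lift_homotopy @ (t, z) --> y) _ e).
  apply: (@cvg_trans _ ((snd : R * C -> C) @ (t, z))); last exact: cvg_snd.
  apply: near_eq_cvg; apply: filterS near_l => p pl.
  by rewrite /lift_homotopy pl.
have [fw wk] := dyn_map_lift t zi.
have nl : ~ (exists m : int, Im z = tau * m%:~R) by apply: right_not_line; lra.
have [k [zk _]] := strip_floor z.
pose K := box (- side n) (2 * side n) (tau * k%:~R) (tau * (k + 1)%:~R).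
have wr : side n.+1 - 1 <= Re (f (lift_homotopy (t, z))).
  by rewrite fw; case: HP => _ _ _ [_ _ Hright]; apply: Hright => //; case: zi.
have inj w : K w -> f w = f (lift_homotopy (t, z)) -> w = lift_homotopy (t, z).
  move=> [_ kw] fE; apply: (strip_inj_Re kw (wk _ zk) fE).
  by rewrite fE; lra.
move=> V VK; suff : \forall p \near (t, z), V (lift_homotopy p) by [].
have := compact_fiber_nbhs (@hausdorffC R) (@compact_box R _ _ _ _) (@continuous_dyn_map R) inj VK.
rewrite fw => nH.
have cH : {for (t, z), continuous (fun p : R * C => H (p.1, f p.2))}.
  apply: (@continuous_comp _ _ _ (fun p : R * C => (p.1, f p.2 : C)) H).
    have cf : {for (t, z), continuous (fun p : R * C => f p.2 : C)}.
      apply: (@continuous_comp _ _ _ (snd : R * C -> C) (f : C -> C)); first exact: cvg_snd.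
      exact: continuous_dyn_map.
    exact: (cvg_pair (@cvg_fst _ _ _ _ _) cf).
  by case: HP => cH _ _ _; apply: cH; case: zi.
have n1 : \forall p \near (t, z), forall w, K w -> f w = H (p.1, f p.2) -> V w.
  exact: (cH _ nH).
have n2 : \forall p \near (t, z), inner j.+1 n p.2.
  have : (snd : R * C -> C) @ (t, z) --> z by exact: cvg_snd.
  by apply; apply: open_nbhs_nbhs; split=> //; exact: open_inner.
have nz : nbhs (z : C) (strip k).
  rewrite nbhsE; exists [set w : C | tau * k%:~R < Im w < tau * (k + 1)%:~R];
    last by move=> w /andP[a b]; rewrite /strip !ltW.
  split; first exact: open_itvIm.
  case/andP: zk => a b; apply/andP; rewrite !lt_neqAle a b !andbT.
  by split; apply/eqP => h; apply: nl; [exists k|exists (k + 1)].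
have n3 : \forall p \near (t, z), strip k p.2.
  have : (snd : R * C -> C) @ (t, z) --> z by exact: cvg_snd.
  by move=> /(_ _ nz).
apply: filterS3 n1 n2 n3 => -[s y] /= h1 h2 h3.
have [fwy wky] := dyn_map_lift s h2.
apply: h1 fwy; split; last exact: wky.
by have [/andP[a b] _] := rect_crect (inner_rect (lift_inner s h2)); rewrite a b.
Qed.

(** The lift of [H] runs up to time [1 / 2], while [clamp] holds the push still; after that the
    lifted points are pushed to the left. *)
Definition lift_push (p : R * C) : C :=
  push (side n - 1) (2 * p.1 - 1, lift_homotopy (2 * p.1, p.2)).

Lemma lift_pushP : push_left_homotopy (inner j.+1 n) (side n - 1) lift_push.
Proof.
have s8 := side_ge8 R n; have s8' := side_ge8 R n.+1.
have lleft t z : inner j.+1 n z -> Re z <= side n - 1 -> lift_homotopy (t, z) = z.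
  move=> [[/andP[x1 x2] /andP[y1 y2]] zi] zl; rewrite /lift_homotopy /=.
  have : csquare n z by split; apply/andP; split; lra.
  by move=> /dyn_map_box[]; rewrite ltr_norml => /andP[h1 h2] _; rewrite ltW.
have lright t z : inner j.+1 n z -> side n - 1 <= Re z ->
    side n - 1 <= Re (lift_homotopy (t, z)).
  move=> zi zr; have [fl|fr] := leP (Re (f z)) (side n.+1 - 1).
    by rewrite /lift_homotopy /= fl.
  by have [_ h _] := lift_right t zi fr; lra.
split.
- move=> t z zi.
  apply: (@continuous_comp _ _ _ (fun p : R * C => (2 * p.1 - 1, lift_homotopy (2 * p.1, p.2)))
    (push (side n - 1))); last exact: continuous_push.
  have c2 : {for (t, z), continuous (fun p : R * C => 2 * p.1)}.
    by apply: cvgM; [exact: cvg_cst|exact: cvg_fst].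
  have c3 : {for (t, z), continuous (fun p : R * C => 2 * p.1 - 1)}.
    by apply: cvgB; [exact: c2|exact: cvg_cst].
  have c4 : {for (t, z), continuous (fun p : R * C => lift_homotopy (2 * p.1, p.2))}.
    apply: (@continuous_comp _ _ _ (fun p : R * C => (2 * p.1, p.2)) lift_homotopy).
      exact: (cvg_pair c2 (@cvg_snd _ _ _ _ _)).
    exact: continuous_lift.
  exact: (cvg_pair c3 c4).
- move=> t z zi; rewrite /lift_push /=.
  have wi := lift_inner (2 * t) zi; set w := lift_homotopy _ in wi *.
  have [t0|t0] := leP (2 * t - 1) 0; first by rewrite push_le0.
  have [wl|wr] := leP (Re w) (side n - 1); first by rewrite push_left.
  have := push_itv (2 * t - 1) (ltW wr); set v := push _ _ => vw.
  have vE : Im v = Im w by [].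
  (* Here [2 t > 1], so [H] has finished and [f w] is left of [side n.+1 - 1]; thus the pushed point
     is mapped into [square n.+1]. *)
  have fw : f w = H (2 * t, f z) by have [] := dyn_map_lift (2 * t) zi.
  have fwl : Re (f w) <= side n.+1 - 1.
    by rewrite fw; case: HP => _ _ _ [Hl _ _]; apply: Hl; [case: zi|lra].
  have [wq wf] := wi.
  split.
    case: wq => /andP[x1 x2] y12; case/andP: vw => a b.
    by split; rewrite ?vE //; apply/andP; split; lra.
  apply: (inner_le (leq0n j)).
  exact: push_preimage_square (inner_rect wf) fwl vw vE.
- move=> t z zi t0; rewrite /lift_push /= push_le0; last by lra.
  by apply: lift_le0 => //; lra.
split.
- by move=> t z zi t1; rewrite /lift_push; apply: push_ge1 => /=; lra.
- by move=> t z zi zl; rewrite /lift_push /= lleft // push_left.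
- move=> t z zi zr; rewrite /lift_push /=.
  by have /andP[] := push_itv (2 * t - 1) (lright (2 * t) z zi zr).
Qed.

End Lift.

Lemma inner_push j n : exists H, push_left_homotopy (inner j n) (side n - 1) H.
Proof.
elim: j n => [|j IH] n; first by exists (push (side n - 1)); exact: square_push.
by have [H HP] := IH n.+1; exists (lift_push n H); exact: lift_pushP HP.
Qed.

End Homotopy.

(** * The web *)

Section Web.
Variable R : realType.
Local Notation C := (R[i]^o).
Local Notation Re := complex.Re.
Local Notation Im := complex.Im.
Local Notation f := (@dyn_map R).
Local Notation tau := (@tau R).
Local Notation side := (@side R).

Definition scale (p : R * C) : C :=
  ((1 - clamp p.1) * Re p.2) +i* ((1 - clamp p.1) * Im p.2).

Lemma continuous_scale : continuous scale.
Proof.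
suff H (p : R * C) : scale @ p --> (scale p : C) by move=> p; exact: H.
have cR : Re q.2 @[q --> p] --> Re p.2.
  by apply: (continuous_comp (@cvg_snd _ _ _ _ _) (@continuous_Re R p.2)).
have cI : Im q.2 @[q --> p] --> Im p.2.
  by apply: (continuous_comp (@cvg_snd _ _ _ _ _) (@continuous_Im R p.2)).
have cC : clamp q.1 @[q --> p] --> clamp p.1.
  apply: (@continuous_comp _ _ _ (fst : R * C -> R) (@clamp R) p); first exact: cvg_fst.
  exact: continuous_clamp.
have cD : 1 - clamp q.1 @[q --> p] --> 1 - clamp p.1 by exact: cvgB (cvg_cst _) cC.
by apply: (cvgCP (F := nbhs p) scale (scale p)).2; split; [exact: cvgM cD cR|exact: cvgM cD cI].
Qed.

Definition contraction (X : set C) (H : R * C -> C) :=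
  [/\ forall t z, X z -> {for (t, z), continuous H},
      forall t z, X z -> X (H (t, z)),
      forall t z, X z -> t <= 0 -> H (t, z) = z &
      forall t z, X z -> 1 <= t -> H (t, z) = 0].

(** Once pushed to [Re <= side n - 1], a point of [rect n] is in [square n], which is star-shaped
    about 0 and can be shrunk radially. *)
Lemma inner_contraction j n : exists H, contraction (inner j n) H.
Proof.
have [H [Hc Hin Hid [Hl _ _]]] := inner_push R j n.
exists (fun p => scale (2 * p.1 - 1, H (2 * p.1, p.2))); split.
- move=> t z zi.
  apply: (@continuous_comp _ _ _ (fun p : R * C => (2 * p.1 - 1, H (2 * p.1, p.2)))
    scale); last exact: continuous_scale.
  have c2 : {for (t, z), continuous (fun p : R * C => 2 * p.1)}.
    by apply: cvgM; [exact: cvg_cst|exact: cvg_fst].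
  have c3 : {for (t, z), continuous (fun p : R * C => 2 * p.1 - 1)}.
    by apply: cvgB; [exact: c2|exact: cvg_cst].
  have c4 : {for (t, z), continuous (fun p : R * C => H (2 * p.1, p.2))}.
    apply: (@continuous_comp _ _ _ (fun p : R * C => (2 * p.1, p.2)) H).
      exact: (cvg_pair c2 (@cvg_snd _ _ _ _ _)).
    exact: Hc.
  exact: (cvg_pair c3 c4).
- move=> t z zi /=; have wi := Hin (2 * t) z zi.
  set w := H _ in wi *.
  have [t0|t0] := leP (2 * t - 1) 0.
    suff -> : scale (2 * t - 1, w) = w by [].
    by apply: complex_ext => /=; rewrite clamp_le0 // subr0 mul1r.
  apply: (inner_le (leq0n j)).
  have wl : Re w <= side n - 1 by apply: Hl => //; lra.
  have [/andP[x1 x2] /andP[y1 y2]] := inner_rect wi.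
  have /andP[c0 c1] := clamp_itv (2 * t - 1).
  have s8 := side_ge8 R n.
  by split=> /=; apply/andP; split; nra.
- move=> t z zi t0 /=; rewrite Hid //; last lra.
  by apply: complex_ext => /=; rewrite clamp_le0 ?subr0 ?mul1r //; lra.
- move=> t z zi t1 /=; apply: complex_ext => /=; rewrite clamp_ge1 ?subrr ?mul0r //; lra.
Qed.

Definition web_dom n : set C := \bigcup_j inner j n.

Lemma inner0 j n : inner j n (0 : C).
Proof.
apply: (inner_le (leq0n j)); have s8 := side_ge8 R n.
by split=> /=; apply/andP; split; lra.
Qed.

Lemma web_dom_rect n : web_dom n `<=` rect n.
Proof. by move=> z [j _]; exact: inner_rect. Qed.

Lemma square_web_dom n : square n `<=` web_dom n.
Proof. by move=> z zs; exists 0%N. Qed.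

Lemma open_web_dom n : open (web_dom n).
Proof. by apply: bigcup_open => j _; exact: open_inner. Qed.

Lemma bounded_web_dom n : bounded_set (web_dom n).
Proof.
apply/bounded_setP; exists (3 * side n) => z /web_dom_rect[/andP[x1 x2] /andP[y1 y2]].
have s8 := side_ge8 R n.
apply: le_trans (normc_le_absD z) _.
have : `|Re z| <= 2 * side n by rewrite ler_norml; apply/andP; split; lra.
have : `|Im z| <= side n by rewrite ler_norml; apply/andP; split; lra.
lra.
Qed.

Lemma web_domS n : web_dom n `<=` web_dom n.+1.
Proof.
move=> z /web_dom_rect[/andP[x1 x2] /andP[y1 y2]]; apply: square_web_dom.
by have sd := side_double R n; have s8 := side_ge8 R n; split; apply/andP; split; lra.
Qed.

Lemma connected_web_dom n : connected (web_dom n).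
Proof.
apply: bigcup_connected; first by exists 0 => j _; exact: inner0.
move=> j _; have [H [Hc Hin Hid H0]] := inner_contraction j n.
apply: (@connected_paths _ _ 0) => z zi.
exists (fun t => H (1 - t, z)); split.
- move=> t; apply: (@continuous_comp _ _ _ (fun t : R => (1 - t, z)) H); last exact: Hc.
  exact: (cvg_pair (cvgB (cvg_cst _) cvg_id) (cvg_cst _)).
- by rewrite H0 // subr0.
- by rewrite Hid // subrr.
- by move=> t _; exact: Hin.
Qed.

(** A closed curve in [web_dom n] thus lies in a single [inner j n], whose contraction can be
    used. *)
Lemma compact_web_dom n (K : set C) : compact K -> K `<=` web_dom n ->
  exists j, K `<=` inner j n.
Proof.
move=> /compact_near_coveringP/(_ nat \oo (fun j z => inner j n z)) cK KG.
case: cK => [z Kz|N _ NK]; last by exists N => z Kz; exact: (NK N (leqnn _)).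
have [j _ zj] := KG z Kz.
exists (inner j n, [set i | (j <= i)%N]).
  split=> /=; last exact: nbhs_infty_ge.
  by apply: open_nbhs_nbhs; split=> //; exact: open_inner.
by move=> [w i] [/= wj ji]; exact: inner_le ji _ wj.
Qed.

Lemma continuous_clamp_comp (g : R -> C) : {within `[0, 1], continuous g} ->
  continuous (g \o @clamp R).
Proof.
move=> /subspace_continuousP cg t.
have tc : `[0, 1]%classic (clamp t) by rewrite /= in_itv /= clamp_itv.
apply: cvg_comp (cg _ tc) => A /= nA.
have n1 : \forall s \near t, `[0, 1]%classic (clamp s) -> A (clamp s).
  exact: (@continuous_clamp R t _ nA).
suff : \forall s \near t, A (clamp s) by [].
by apply: filterS n1 => s; apply; rewrite /= in_itv /= clamp_itv.
Qed.

Lemma simply_connected_web_dom n : simply_connected_domain (web_dom n).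
Proof.
split.
  split; [exact: open_web_dom|exact: connected_web_dom|].
  by exists 0; exists 0%N => //; exact: inner0.
move=> g cg gG g01.
have cgc := continuous_clamp_comp cg.
have [j gj] : exists j, g @` `[0, 1] `<=` inner j n.
  apply: compact_web_dom; first by apply: (continuous_compact cg); exact: segment_compact.
  by move=> _ [t t01 <-]; exact: gG.
have gcj t : inner j n (g (clamp t)).
  by apply: gj; exists (clamp t) => //=; rewrite in_itv /= clamp_itv.
have [H [Hc Hin Hid H0]] := inner_contraction j n.
(* The curve is contracted pointwise to 0. Its base point moves, and each stage is closed because
   [g 0 = g 1]. *)
exists (fun p => H (p.1, g (clamp p.2))), 0; split.
- apply: continuous_subspaceT => -[s t].
  apply: (@continuous_comp _ _ _ (fun p : R * R => (p.1, g (clamp p.2))) H); last exact: Hc.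
  have c2 : {for (s, t), continuous (fun p : R * R => g (clamp p.2))}.
    apply: (@continuous_comp _ _ _ (snd : R * R -> R) (g \o @clamp R)); first exact: cvg_snd.
    exact: cgc.
  exact: (cvg_pair (@cvg_fst _ _ _ _ _) c2).
- by move=> s t _ _; exists j => //; exact: Hin.
- by move=> t; rewrite in_itv => t01; rewrite /= Hid // clamp_id.
- by move=> t _; rewrite /= H0.
- by move=> s _; rewrite /= clamp_le0 // clamp_ge1 // g01.
Qed.

(** It contains the boundary of [web_dom n] and, unlike the boundary, is described recursively along
    orbits. *)
Definition web_edge n : set C := (\bigcap_j outer j n) `\` web_dom n.

Lemma boundary_web_dom n : boundary (web_dom n) `<=` web_edge n.
Proof.
move=> z [cz nz]; split; last first.
  by move=> zG; apply: nz; move/interior_id: (@open_web_dom n) => ->.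
move=> j _; have : closure (outer j n) z.
  by apply: closure_subset cz => w [i _]; exact: inner_outer.
by have /closure_id <- := @closed_outer R j n.
Qed.

Lemma web_edge_cases n z : web_edge n z -> [\/ Re z = - side n,
  Im z = side n \/ Im z = - side n |
  side n <= Re z /\ web_edge n.+1 (f z)].
Proof.
have s8 := side_ge8 R n.
move=> [zo zG]; have [/andP[x1 x2] /andP[y1 y2]] := outer_crect (zo 0%N I).
have [|xn] := eqVneq (Re z) (- side n); first by constructor 1.
have [|yn] := eqVneq (Im z) (side n); first by constructor 2; left.
have [|ym] := eqVneq (Im z) (- side n); first by constructor 2; right.
have {}x1 : - side n < Re z by rewrite lt_neqAle eq_sym xn x1.
have {}y1 : - side n < Im z by rewrite lt_neqAle eq_sym ym y1.
have {}y2 : Im z < side n by rewrite lt_neqAle yn y2.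
have fo j : outer j n.+1 (f z) by have [] := zo j.+1 I.
have xN : Re z < 2 * side n.
  by apply: crect_Re_lt (fo 0%N); rewrite ler_norml; apply/andP; split; lra.
have zr : rect n z by split; apply/andP; split.
constructor 3; split.
  rewrite leNgt; apply/negP => xs; apply: zG; apply: square_web_dom.
  by split; apply/andP; split.
split; first by move=> j _; exact: fo.
by move=> [j _ fi]; apply: zG; exists j.+1.
Qed.

(** * Growth of orbits on the web *)

Lemma sqrt2_bounds : 1 <= Num.sqrt 2 :> R /\ Num.sqrt 2 <= 3 / 2 :> R.
Proof.
have s0 := sqrtr_ge0 (2 : R); have s2 : Num.sqrt 2 ^+ 2 = 2 :> R by rewrite sqr_sqrtr //; lra.
by split; nra.
Qed.

(** One step sends the real part [x] to at most [2 x + 3], and this is at most [(3 / 2) x] for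
    [x <= - 6]. The threshold [- 8] puts the left sides of all rectangles into this half plane. *)
Lemma iter_left i (z : C) : Re z <= - 8 ->
  Re (iter i f z) <= Num.sqrt 2 ^+ i * Re z.
Proof.
move=> x8; have [q1 q2] := sqrt2_bounds.
elim: i => [|i IH]; first by rewrite expr0 mul1r.
have p1 : 1 <= Num.sqrt 2 ^+ i :> R by rewrite exprn_ege1.
have x0 : Re (iter i f z) <= - 8 by nra.
have := @dyn_map_left R (iter i f z); rewrite iterS exprS => h.
have {}h : Re (f (iter i f z)) <= 2 * Re (iter i f z) + 3 by apply: h; lra.
nra.
Qed.

Lemma iter_line i (z : C) (l : int) : Im z = tau * l%:~R ->
  exists m : int, Im (iter i f z) = tau * m%:~R /\ Im (iter i f z) = 2 ^+ i * Im z.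
Proof.
move=> zl; elim: i => [|i [m [h1 h2]]]; first by exists l; rewrite expr0 mul1r.
exists (2 * m); rewrite iterS (dyn_map_line h1) /=; split; first by rewrite intrM; ring.
by rewrite -h1 h2 exprS mulrA.
Qed.

Lemma sqrt2_le2X i : Num.sqrt 2 ^+ i <= 2 ^+ i :> R.
Proof. by have [q1 q2] := sqrt2_bounds; apply: lerXn2r; rewrite ?nnegrE; lra. Qed.

Lemma normc_left i (z : C) : Re z <= - 8 ->
  Num.sqrt 2 ^+ i * - Re z <= normc (iter i f z).
Proof.
move=> x8; apply: le_trans (normc_ge_absRe _).
by rewrite mulrN -[leRHS]normrN (le_trans _ (ler_norm _)) // lerN2 iter_left.
Qed.

Lemma normc_line i (z : C) (l : int) : Im z = tau * l%:~R ->
  Num.sqrt 2 ^+ i * `|Im z| <= normc (iter i f z).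
Proof.
move=> /(iter_line i)[m [_ h]]; apply: le_trans (normc_ge_absIm _).
by rewrite h normrM normrX ger0_norm // ler_wpM2r // sqrt2_le2X.
Qed.

(** The exponent [n + i] is invariant under passing from [z] in [web_edge n] to [f z] in
    [web_edge n.+1]. On the other sides the growth factor [sqrt 2 ^ i] multiplies [side n], which is
    at least [sqrt 2 ^ n]. *)
Lemma web_edge_growth i n z : web_edge n z ->
  Num.sqrt 2 ^+ (n + i) <= normc (iter i f z).
Proof.
elim: i n z => [|i IH] n z ze.
  rewrite addn0; apply: le_trans (side_ge_sqrt R n) _.
  have [xE|yE|[xs _]] := web_edge_cases ze.
  - by apply: le_trans (normc_ge_absRe _); rewrite xE normrN ler_norm.
  - by apply: le_trans (normc_ge_absIm _); case: yE => ->; rewrite ?normrN ler_norm.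
  - by apply: le_trans (normc_ge_absRe _); rewrite (le_trans xs) // ler_norm.
have s8 := side_ge8 R n; have q0 : 0 <= Num.sqrt 2 ^+ i.+1 :> R.
  by rewrite exprn_ge0 // sqrtr_ge0.
have sE : side n = tau * (half_width R n)%:Z%:~R by rewrite /side pmulrn.
have [xE|yE|[xs fe]] := web_edge_cases ze.
- apply: le_trans (normc_left _ _); last by lra.
  by rewrite xE opprK exprD mulrC ler_wpM2l // side_ge_sqrt.
- have [l zl] : exists l : int, Im z = tau * l%:~R.
    case: yE => ->; first by exists (half_width R n)%:Z.
    by exists (- (half_width R n)%:Z); rewrite mulrNz mulrN -sE.
  apply: le_trans (normc_line i.+1 zl).
  rewrite exprD mulrC ler_wpM2l //.
  have -> : `|Im z| = side n by case: yE => ->; rewrite ?normrN ger0_norm //; lra.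
  exact: side_ge_sqrt.
- by rewrite addnS -addSn iterSr; exact: IH.
Qed.

Lemma web_edge_I_seq n : web_edge n `<=` I_seq f (fun n => Num.sqrt 2 ^+ n).
Proof.
move=> z ze i _; apply: le_trans (web_edge_growth i ze).
have [q1 _] := sqrt2_bounds.
by rewrite exprD ler_peMl ?exprn_ege1 // exprn_ge0 // sqrtr_ge0.
Qed.

Definition left_half : set C := [set z | Re z <= - 8].

Lemma left_half_I_seq : left_half `<=` I_seq f (fun n => Num.sqrt 2 ^+ n).
Proof.
move=> z z8 i _; apply: le_trans (normc_left i z8).
rewrite ler_peMr ?exprn_ge0 ?sqrtr_ge0 //.
by move: z8; rewrite /left_half /=; lra.
Qed.

Lemma connected_left_half : connected left_half.
Proof.
apply: (@connected_star _ _ ((- 8) +i* 0)) => z t; rewrite /left_half /= => z8 /andP[t0 t1].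
nra.
Qed.

(** * Connectedness of the web *)

Definition rim_lim n : set C := \bigcap_j rim j n.

Lemma rim_lim_web_edge n : rim_lim n `<=` web_edge n.
Proof.
move=> z zr; split; first by move=> j _; have [] := zr j I.
by move=> [j _ zi]; have [_] := zr j I; apply; left.
Qed.

Lemma web_edge_split n : web_edge n `<=` left_half `|` rim_lim n.
Proof.
move=> z [zo zG]; have [hl|hl] := pselect (left_slab n z); last first.
  right => j _; split; first exact: zo.
  by move=> [zi|//]; apply: zG; exists j.
left; have [/andP[x1 _] _] := outer_crect (zo 0%N I).
have s8 := side_ge8 R n; rewrite /left_half /=.
suff : Re z <= - side n by lra.
rewrite leNgt; apply/negP => x1'; apply: zG; apply: square_web_dom.
by case: hl => a b; split=> //; apply/andP.
Qed.

Lemma connected_rim_lim n : connected (rim_lim n).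
Proof.
apply: bigcap_connected => j; [exact: compact_rim|exact: rim_connected|exact: rimS].
Qed.

(** The half plane supplies the left parts of all boundaries and joins the limit rims, each of which
    meets it in a corner. *)
Definition web : set C := \bigcup_n (left_half `|` rim_lim n).

Lemma connected_web : connected web.
Proof.
apply: bigcup_connected.
  by exists ((- 8) +i* 0) => n _; left; rewrite /left_half /=.
move=> n _; apply: connectedU; [|exact: connected_left_half|exact: connected_rim_lim].
have s8 := side_ge8 R n.
exists (- side n +i* side n); split; first by rewrite /left_half /=; lra.
move=> j _; apply: rim_csquare.
- by split=> /=; apply/andP; split; lra.
- by move=> [/andP[]] /=; rewrite ltxx.
- by move=> [_ /andP[]] /=; rewrite ltxx.
Qed.

Lemma web_I_seq : web `<=` I_seq f (fun n => Num.sqrt 2 ^+ n).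
Proof.
move=> z [n _ [/left_half_I_seq //|/rim_lim_web_edge]]; exact: web_edge_I_seq.
Qed.

Lemma boundary_web n : boundary (web_dom n) `<=` web.
Proof. by move=> z /boundary_web_dom/web_edge_split zw; exists n. Qed.

Lemma side_unbounded (A : R) : exists n, A <= side n.
Proof.
exists (Num.truncn `|A|).+1; apply: le_trans (side_ge_nat R _).
apply: le_trans (ler_norm A) (ltW _).
by have /andP[] := Num.Theory.truncn_itv (normr_ge0 A).
Qed.

Lemma bigcup_web_dom : \bigcup_n web_dom n = setT.
Proof.
apply/seteqP; split=> // z _; have [n h] := side_unbounded (`|Re z| + `|Im z| + 1).
exists n => //; apply: square_web_dom.
have := normr_ge0 (Re z); have := normr_ge0 (Im z) => h1 h2.
have : `|Re z| < side n by lra.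
have : `|Im z| < side n by lra.
by rewrite !ltr_norml.
Qed.

Lemma spiders_web_of_web (E : set C) : web `<=` E -> connected E -> spiders_web E.
Proof.
move=> wE cE; split=> //; exists web_dom; split.
- exact: bounded_web_dom.
- exact: simply_connected_web_dom.
- exact: web_domS.
- by move=> n z /boundary_web /wE.
- exact: bigcup_web_dom.
Qed.

End Web.

(** * Escaping points on horizontal lines *)

Section Escaping.
Variable R : realType.
Local Notation C := (R[i]^o).
Local Notation Re := complex.Re.
Local Notation Im := complex.Im.
Local Notation f := (@dyn_map R).
Local Notation tau := (@tau R).
Local Notation side := (@side R).
Local Notation esc := (escaping_set f).

Lemma escapingP (z : C) : esc z <->
  forall A : R, exists N, forall n, (N <= n)%N -> A <= normc (iter n f z).
Proof.
split=> [/cvgryPge h A|h].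
  by have [N _ hN] := h A; exists N => n; exact: hN.
by apply/cvgryPge => A; have [N hN] := h A; exists N.
Qed.

Lemma escaping_dyn_map (z : C) : esc z <-> esc (f z).
Proof.
split=> /escapingP h; apply/escapingP => A; have [N hN] := h A.
  by exists N => n Nn; rewrite -iterSr; apply: hN; exact: leqW.
exists N.+1 => -[//|n] Nn; rewrite iterSr; exact: hN.
Qed.

Lemma escaping_iter n (z : C) : esc z <-> esc (iter n f z).
Proof.
elim: n => [//|n IH]; rewrite iterS.
exact: (iff_trans IH (escaping_dyn_map _)).
Qed.

Lemma sqrt2X_ge (n : nat) : 1 + n%:R * (2 / 5) <= Num.sqrt 2 ^+ n :> R.
Proof.
have s0 := sqrtr_ge0 (2 : R); have s2 : Num.sqrt 2 ^+ 2 = 2 :> R by rewrite sqr_sqrtr //; lra.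
have s1 : 7 / 5 <= Num.sqrt 2 :> R by nra.
elim: n => [|n IH]; first by rewrite expr0 mul0r addr0.
rewrite exprS -natr1; have n0 : 0 <= n%:R :> R by exact: ler0n.
nra.
Qed.

Lemma I_seq_escaping : I_seq f (fun n => Num.sqrt 2 ^+ n) `<=` esc.
Proof.
move=> z zI; apply/escapingP => A.
exists (Num.truncn (5 / 2 * `|A|)).+1 => n Nn.
apply: le_trans (zI n (leq_ltn_trans (leq0n _) Nn)).
apply: le_trans (sqrt2X_ge n).
have A0 : 0 <= 5 / 2 * `|A| by rewrite mulr_ge0 //; lra.
have /andP[_ h] := Num.Theory.truncn_itv A0.
have : ((Num.truncn (5 / 2 * `|A|)).+1)%:R <= n%:R :> R by rewrite ler_nat.
have := ler_norm A; lra.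
Qed.

Lemma escaping_line (z : C) (l : int) : Im z = tau * l%:~R -> l != 0 -> esc z.
Proof.
move=> zl l0; apply: I_seq_escaping => n _; apply: le_trans (normc_line n zl).
rewrite ler_peMr ?exprn_ge0 ?sqrtr_ge0 // zl normrM.
have t4 := tau_ge4 R; rewrite ger0_norm; last by lra.
have : 1 <= `|l%:~R| :> R.
  by rewrite -intr_norm -[1]/(1%:~R) ler_int; lia.
nra.
Qed.

Lemma iter_real n (x : R) : iter n f (x +i* 0) = (iter n (@phi R) x) +i* 0.
Proof.
elim: n => [//|n IH]; rewrite !iterS IH.
by rewrite (@dyn_map_line R _ 0) /= ?mulr0 // mulr0.
Qed.

Lemma escaping_realP (x : R) : esc (x +i* 0) <->
  forall A : R, exists N, forall n, (N <= n)%N -> A <= `|iter n (@phi R) x|.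
Proof.
have nE n : normc (iter n f (x +i* 0)) = `|iter n (@phi R) x|.
  by rewrite iter_real /= expr0n addr0 sqrtr_sqr.
split=> [/escapingP h A|h].
  by have [N hN] := h A; exists N => n; rewrite -nE; exact: hN.
by apply/escapingP => A; have [N hN] := h A; exists N => n; rewrite nE; exact: hN.
Qed.

Lemma iter_phi_le_ln2 n (x : R) : x <= ln 2 -> iter n (@phi R) x <= ln 2.
Proof. by case: n => [//|n _]; rewrite iterS; exact: phi_le_ln2. Qed.

Lemma iter_phi_le n (x x' : R) : x' <= x -> x <= ln 2 ->
  iter n (@phi R) x' <= iter n (@phi R) x.
Proof.
move=> xx x2; elim: n => [//|n IH]; rewrite !iterS.
by apply: phi_le_left => //; exact: iter_phi_le_ln2.
Qed.

(** On the invariant half line up to [ln 2], [phi] is increasing. An orbit escapes there only to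
    minus infinity and drags every orbit below it along. *)
Lemma escaping_real_left (x x' : R) : x' <= x -> x <= ln 2 ->
  esc (x +i* 0) -> esc (x' +i* 0).
Proof.
move=> xx x2 /escaping_realP h; apply/escaping_realP => A.
have [N hN] := h (`|A| + 2); exists N => n /hN.
have := iter_phi_le n xx x2; have := iter_phi_le_ln2 n x2.
have /andP[l0 l1] := ln2_bounds R.
set a := iter n _ x; set b := iter n _ x' => a2 ba ha.
have a0 : a <= 0.
  rewrite leNgt; apply/negP => a0; move: ha; rewrite (gtr0_norm a0).
  by have := normr_ge0 A; lra.
have b0 : b <= 0 by exact: le_trans a0.
by move: ha; rewrite (ler0_norm a0) (ler0_norm b0); have := ler_norm A; lra.
Qed.

(** One step of [phi] reverses the order and leads to the half line up to [ln 2]. *)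
Lemma escaping_real_right (x x' : R) : ln 2 <= x -> x <= x' ->
  esc (x +i* 0) -> esc (x' +i* 0).
Proof.
rewrite [x <= x']le_eqVlt => x2 /orP[/eqP-> //|xx].
have fE y : f (y +i* 0) = phi y +i* 0 by rewrite (@dyn_map_line R _ 0) /= ?mulr0 // mulr0.
move=> /escaping_dyn_map; rewrite fE => h; apply/escaping_dyn_map; rewrite fE.
apply: escaping_real_left h; last exact: phi_le_ln2.
by rewrite ltW // phi_lt.
Qed.

(* With the lines included, an orbit of escaping points that avoids [frame]
   stays in the open strips, where [f] is an open map. *)
Definition frame : set C :=
  @web R `|` [set z | esc z /\ exists l : int, Im z = tau * l%:~R].

Lemma frame_escaping : frame `<=` esc.
Proof. by move=> z [/web_I_seq/I_seq_escaping|[]]. Qed.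

Lemma frame_line (z : C) : esc z -> (exists l : int, Im z = tau * l%:~R) -> frame z.
Proof. by right. Qed.

Lemma left_half_web : @left_half R `<=` @web R.
Proof. by move=> z h; exists 0%N => //; left. Qed.

(** Each added point is joined to the web by a horizontal segment of escaping points: to the left
    half plane, or, on the real axis to the right of [ln 2], to the point [q] of the web. *)
Lemma connected_frame : connected frame.
Proof.
have w0 : @web R ((- 8) +i* 0) by apply: left_half_web; rewrite /left_half /=.
have /andP[l0 l1] := ln2_bounds R.
suff S z : frame z -> exists P : set C, [/\ connected P, @web R `<=` P, P `<=` frame & P z].
  have S' z : exists P : set C, frame z ->
      [/\ connected P, @web R `<=` P, P `<=` frame & P z].
    by have [/S[P PP]|nz] := pselect (frame z); [exists P|exists set0].
  have [P PP] := choice S'.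
  have -> : frame = \bigcup_(z in frame) P z.
    apply/seteqP; split=> [z fz|z [w fw]]; first by exists z => //; case: (PP z fz).
    by case: (PP w fw) => _ _ h _; exact: h.
  apply: bigcup_connected => [|z fz]; last by case: (PP z fz).
  by exists ((- 8) +i* 0) => z fz; case: (PP z fz) => _ h _ _; exact: h.
move=> fz.
suff [P [cP [p [wp Pp]] PF Pz]] : exists P : set C,
    [/\ connected P, exists p, @web R p /\ P p, P `<=` frame & P z].
  exists (@web R `|` P); split; [|by left| |by right].
    by apply: connectedU => //; [exists p|exact: connected_web].
  by move=> w [|/PF //]; left.
case: fz => [wz|[ez [l zl]]].
  by exists [set z]; split=> //; [exact: connected1|exists z|move=> _ ->; left].
have [l0E|ln0] := eqVneq l 0; last first.
  pose m := Num.min (Re z) (- 8).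
  exists (box m (Re z) (Im z) (Im z)).
  have mz : m <= Re z by rewrite ge_min lexx.
  split; first exact: connected_box.
  - exists (m +i* Im z); split; last by split; rewrite /= !lexx.
    by apply: left_half_web; rewrite /left_half /= ge_min lexx orbT.
  - move=> w [_ /andP[a b]]; have wE : Im w = tau * l%:~R.
      by rewrite -zl; apply/eqP; rewrite eq_le a b.
    by apply: frame_line; [exact: escaping_line wE ln0|exists l].
  - by split; rewrite !lexx ?mz.
have z0 : Im z = 0 by rewrite zl l0E mulr0.
have zE : z = Re z +i* 0 by apply: complex_ext.
have real_frame w : Im w = 0 -> esc (Re w +i* 0) -> frame w.
  move=> w0' ew; apply: frame_line; last by exists 0; rewrite mulr0.
  by have -> : w = Re w +i* 0 by apply: complex_ext.
rewrite zE in ez.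
have [zl2|zl2] := leP (Re z) (ln 2).
  pose m := Num.min (Re z) (- 8).
  exists (box m (Re z) 0 0).
  have mz : m <= Re z by rewrite ge_min lexx.
  split; first exact: connected_box.
  - exists (m +i* 0); split; last by split; rewrite /= !lexx ?mz.
    by apply: left_half_web; rewrite /left_half /= ge_min lexx orbT.
  - move=> w [/andP[a b] /andP[c d]]; apply: real_frame; first lra.
    exact: escaping_real_left b zl2 ez.
  - by split; rewrite ?z0 !lexx ?mz.
have [q /andP[q1 q2] qE] := cut_point R 0.
have s8 := side_ge8 R 0; have s8' := side_ge8 R 1.
(* The image of [q] is the midpoint of the left side of [crect 1], which lies in every [outer j 1]
   but in no [inner j 1]. *)
have wq : @web R (q +i* 0).
  have fq : f (q +i* 0) = (- side 1) +i* 0.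
    by rewrite (@dyn_map_line R _ 0) /= !mulr0 ?qE.
  exists 0%N => //; right => j _; split; last first.
    move=> [qi|[/= ql _]]; last by lra.
    case: j qi => [[/andP[/= a b] _]|j [_]]; first lra.
    by rewrite /preimage /= fq => /inner_rect[/andP[/= a b] _]; lra.
  case: j => [|j]; first by split=> /=; apply/andP; split; lra.
  split; first by split=> /=; apply/andP; split; lra.
  rewrite /preimage /= fq; apply: csquare_outer.
  by split=> /=; apply/andP; split; lra.
have eq : esc (q +i* 0) by apply: I_seq_escaping; exact: web_I_seq.
pose m := Num.min (Re z) q; pose M := Num.max (Re z) q.
exists (box m M 0 0); split; first exact: connected_box.
- exists (q +i* 0); split=> //; split; rewrite /= ?lexx //.
  by rewrite ge_min le_max lexx !orbT.
- move=> w [/andP[a b] /andP[c d]]; apply: real_frame; first lra.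
  have [zq|qz] := leP (Re z) q.
    have mE : m = Re z by apply/min_idPl.
    by apply: escaping_real_right ez; [exact: ltW|rewrite -mE].
  have mE : m = q by apply/min_idPr; exact: ltW.
  by apply: escaping_real_right eq; [lra|rewrite -mE].
- by split; rewrite ?z0 ?lexx // ge_min le_max lexx.
Qed.

(** Every [w] near [f z] has a preimage in the strip of [z]. It lies in the compact box [K], since
    further left or right the image is too large, and in [A] because [z] is the only point of [K]
    over [f z]. *)
Lemma dyn_map_open (z : C) (A : set C) : ~ (exists l : int, Im z = tau * l%:~R) ->
  nbhs z A -> nbhs (f z : C) (f @` A).
Proof.
move=> nl zA; have [k [zk _]] := strip_floor z.
have [n hn] := side_unbounded (`|tau * k%:~R| + `|tau * (k + 1)%:~R| +
  `|Re (f z)| + `|Im (f z)| + 1).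
have h1 := normr_ge0 (tau * k%:~R); have h2 := normr_ge0 (tau * (k + 1)%:~R).
have h3 := normr_ge0 (Re (f z)); have h4 := normr_ge0 (Im (f z)).
pose B := 2 * side n.+1.
have sd := side_double R n; have s8 := side_ge8 R n.
pose K := box (- B) B (tau * k%:~R) (tau * (k + 1)%:~R).
have inj w : K w -> f w = f z -> w = z.
  move=> [_ wk] fE; have [//|[E [l El]]] := strip_inj wk zk fE.
  by exfalso; apply: nl; exists l; rewrite -E.
have := compact_fiber_nbhs (@hausdorffC R) (@compact_box R _ _ _ _)
  (@continuous_dyn_map R) inj zA.
have fs : nbhs (f z : C) (@square R n).
  apply: open_nbhs_nbhs; split; first exact: open_square.
  have : `|Re (f z)| < side n by lra.
  have : `|Im (f z)| < side n by lra.
  by rewrite !ltr_norml.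
apply: filterS2 fs => w [/andP[u1 u2] /andP[v1 v2]] wA.
have [y [yk yw _]] := dyn_map_surj_strip k w.
exists y => //; apply: (wA y _ yw); split=> //.
have yn : `|Im y| <= side n.
  case/andP: yk => a b; rewrite ler_norml; apply/andP; split.
    by have := ler_norm (- (tau * k%:~R)); rewrite normrN; lra.
  by have := ler_norm (tau * (k + 1)%:~R); lra.
apply/andP; split.
  rewrite leNgt; apply/negP => yl; rewrite /B in yl.
  have y0 : Re y <= 0 by lra.
  by have := dyn_map_left y0; rewrite yw; lra.
rewrite leNgt; apply/negP => yr; rewrite /B in yr.
have yr' : 2 * side n <= Re y by lra.
have := dyn_map_right yr' yn; rewrite yw.
have : `|Re w| <= side n by rewrite ler_norml !ltW.
have : `|Im w| <= side n by rewrite ler_norml !ltW.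
lra.
Qed.

End Escaping.

(** * Connectedness of the escaping set *)

Lemma open_connected_component (R : realType) (A : set R[i]^o) (x : R[i]^o) :
  open A -> open (connected_component A x).
Proof.
move=> oA; rewrite openE => y Ay.
have yA : A y by have := @connected_component_sub _ A x; apply.
have /nbhs_boxP[e e0 eA] : nbhs y A by exact: open_nbhs_nbhs.
pose B := box (complex.Re y - e / 2) (complex.Re y + e / 2)
              (complex.Im y - e / 2) (complex.Im y + e / 2).
have yB : B y by split; apply/andP; split; lra.
have BA : B `<=` A.
  move=> w [/andP[a b] /andP[c d]]; apply: eA; rewrite ltr_norml; apply/andP; split; lra.
have [D [Dx DA cD] Dy] := Ay.
apply/nbhs_boxP; exists (e / 2) => [|w h1 h2]; first by lra.
exists (D `|` B); last first.
  right; move: h1 h2; rewrite !ltr_norml => /andP[a b] /andP[c d].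
  by split; apply/andP; split; lra.
split; first by left.
  by move=> v [/DA|/BA].
by apply: connectedU => //; [exists y|exact: connected_box].
Qed.

Lemma connected_avoid_boundary (R : realType) (A G : set R[i]^o) : open G ->
  connected A -> A `&` boundary G = set0 -> ~ (A `<=` G) -> A `&` G = set0.
Proof.
move=> oG cA AG nAG; apply/eqP/negPn/negP => /set0P ne.
have E : A `&` G = A `&` closure G.
  apply/seteqP; split=> z [Az Gz]; split=> //; first exact: subset_closure.
  apply: contrapT => nGz; have : (A `&` boundary G) z.
    by split=> //; split=> // /interior_subset.
  by rewrite AG.
apply: nAG; rewrite -[X in X `<=` _](cA (A `&` G) ne).
- exact: subIsetr.
- by exists G.
- by exists (closure G) => //; exact: closed_closure.
Qed.

Section Connectedness.
Variable R : realType.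
Local Notation C := (R[i]^o).
Local Notation Re := complex.Re.
Local Notation Im := complex.Im.
Local Notation f := (@dyn_map R).
Local Notation tau := (@tau R).
Local Notation side := (@side R).
Local Notation esc := (escaping_set f).
Local Notation frame := (@frame R).
Local Notation itf n := (iter n f : C -> C).

Lemma continuous_iter n : continuous (iter n f : C -> C).
Proof.
elim: n => [|n IH] z; first exact: cvg_id.
exact: (@continuous_comp _ _ _ (iter n f : C -> C) (f : C -> C) z (IH z) (@continuous_dyn_map R _)).
Qed.

Lemma frame_unbounded (M : R) : exists2 z, frame z & M < `|Re z|.
Proof.
exists (- (`|M| + 8) +i* 0).
  by left; apply: left_half_web; rewrite /left_half /=; have := normr_ge0 M; lra.
rewrite /= normrN ger0_norm; last first.
  by have := normr_ge0 M; lra.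
by have := ler_norm M; lra.
Qed.

(* Images of a bounded domain whose boundary consists of non-escaping points
   cannot meet the frame: being connected and unbounded, the frame would have
   to cross the boundary of the image. *)
Lemma iter_avoid_frame (V : set C) : open V -> bounded_set V ->
  (forall b, closure V b -> esc b -> V b) -> V `&` frame = set0 ->
  forall n, (itf n @` V) `&` frame = set0.
Proof.
move=> oV /bounded_setP[M VM] Vb VF.
have cK : compact (closure V).
  apply: (subclosed_compact (@closed_closure _ _) (@compact_box R (- M) M (- M) M)).
  have cb := compact_closed (@hausdorffC R) (@compact_box R (- M) M (- M) M).
  rewrite ((closure_id _).1 cb); apply: closure_subset => z /VM h.
  have := le_trans (normc_ge_absRe z) h; have := le_trans (normc_ge_absIm z) h.
  by rewrite !ler_norml => h1 h2; split.
move=> n; have [m] := ubnP n; elim: m n => // m IH n; rewrite ltnS => nm.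
apply/eqP/negPn/negP => /set0P ne.
have cKn : compact (itf n @` closure V).
  by apply: continuous_compact cK; apply: continuous_subspaceT; exact: continuous_iter.
(* Points of [closure V] mapped into the frame escape, hence are in [V]. So the intersection is
   closed in the frame. *)
have E1 : (itf n @` V) `&` frame = frame `&` (itf n @` closure V).
  apply/seteqP; split=> [z [[v Vv <-] fz]|z [fz [v cv vz]]].
    by split=> //; exists v => //; exact: subset_closure.
  split=> //; exists v => //; apply: Vb => //.
  by apply/(escaping_iter n); rewrite vz; exact: frame_escaping.
(* The earlier images of [V] miss the frame, so the escaping orbit of [v] is off the lines before
   time [n], where [f] is open. So the intersection is also open in the frame. *)
have nb v : V v -> frame (iter n f v) -> forall k, (k <= n)%N ->
    nbhs (iter k f v : C) (itf k @` V).
  move=> Vv fv; elim=> [_|k IHk kn].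
    by rewrite image_id; exact: open_nbhs_nbhs.
  have ek : esc (iter k f v).
    apply: (escaping_iter k v).1; apply: (escaping_iter n v).2; exact: frame_escaping.
  have nl : ~ (exists l : int, Im (iter k f v) = tau * l%:~R).
    move=> h; have : ((itf k @` V) `&` frame) (iter k f v).
      by split; [exists v|exact: frame_line].
    by rewrite IH // (leq_trans kn).
  have := dyn_map_open nl (IHk (ltnW kn)); rewrite -image_comp /=.
  by apply.
have E2 : (itf n @` V) `&` frame = frame `&` (itf n @` V)^°.
  apply/seteqP; split=> [z [[v Vv <-] fz]|z [fz h]]; last by split=> //; exact: interior_subset.
  by split=> //; apply: nb.
have E : (itf n @` V) `&` frame = frame.
  apply: (@connected_frame R) => //.
    by exists (itf n @` V)^° => //; exact: open_interior.
  by exists (itf n @` closure V) => //; exact: compact_closed (@hausdorffC R) cKn.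
have cR : compact ((@complex.Re R : C -> R) @` (itf n @` closure V)).
  by apply: continuous_compact cKn; apply: continuous_subspaceT; exact: continuous_Re.
have [B [_ KB]] := compact_bounded cR.
have [z fz] := frame_unbounded (B + 1); rewrite ltNge => /negP; apply.
apply: (KB (B + 1)); first by rewrite ltrDl.
exists z => //; move: fz; rewrite -E => -[[v Vv <-] _].
by exists v => //; exact: subset_closure.
Qed.

Lemma bounded_open_not_closed (V : set C) : open V -> bounded_set V -> V !=set0 ->
  exists2 b, closure V b & ~ V b.
Proof.
move=> oV /bounded_setP[M VM] V0; apply: contrapT => h.
have cV : closed V.
  by move=> b cb; apply: contrapT => nb; apply: h; exists b.
have cT : connected (setT : set C) by apply: (@connected_star _ _ 0).
have VT : V = setT.
  by apply: cT => //; [exists V|exists V]; rewrite // setTI.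
have := VM ((`|M| + 1) +i* 0); rewrite VT => /(_ I).
have := normc_ge_absRe ((`|M| + 1) +i* 0 : C); rewrite /= ger0_norm; last first.
  by have := normr_ge0 M; lra.
by have := ler_norm M; lra.
Qed.

Lemma normc_web_dom m z : ~ @web_dom R m z -> side m <= normc z.
Proof.
move=> h; rewrite leNgt; apply/negP => zm; apply: h; apply: square_web_dom.
have := le_lt_trans (normc_ge_absRe z) zm; have := le_lt_trans (normc_ge_absIm z) zm.
by rewrite !ltr_norml.
Qed.

Lemma connected_escaping : connected (esc : set C).
Proof.
apply/connectedP => E [E0 EU sE].
wlog FE : E E0 EU sE / frame `<=` E false.
  move=> G; have FU : frame `<=` E false `|` E true by rewrite -EU; exact: frame_escaping.
  have [h|h] := connected_subset sE FU (@connected_frame R); first exact: (G E).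
  by apply: (G (E \o negb)) => //; [move=> b; exact: E0|rewrite EU setUC|rewrite separatedC].
have [U [V [oU oV EfU EtV UV0]]] := separated_open sE.
have [z Etz] := E0 true.
have escT w : E true w -> esc w by move=> h; rewrite /= EU; right.
have ez := escT _ Etz.
have UV w : closure V w -> ~ U w.
  move=> cw Uw; have [y [Vy Uy]] := cw _ (open_nbhs_nbhs (conj oU Uw)).
  by have : (U `&` V) y by []; rewrite UV0.
have [m _ zm] : (\bigcup_m @web_dom R m) z by rewrite bigcup_web_dom.
pose V1 := V `&` @web_dom R m.
have oV1 : open V1 by apply: openI => //; exact: open_web_dom.
have V1z : V1 z by split=> //; exact: EtV.
pose V0 := connected_component V1 z.
have oV0 : open V0 by exact: open_connected_component.
have V0V1 : V0 `<=` V1 by exact: connected_component_sub.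
have V0z : V0 z by exact: connected_component_refl.
have bV0 : bounded_set V0.
  have /bounded_setP[M hM] := @bounded_web_dom R m.
  by apply/bounded_setP; exists M => w /V0V1[_ /hM].
(* An escaping [b] in the closure is in [V], because [closure V] misses [U]; it is in [web_dom m],
   whose boundary lies in [U]; and components of [V1] are closed in [V1]. *)
have Vb b : closure V0 b -> esc b -> V0 b.
  move=> cb eb; have cVb : closure V b by apply: closure_subset cb => w /V0V1[].
  have [Ub|Etb] : U b \/ E true b.
    by move: eb; rewrite /= EU => -[/EfU|]; [left|right].
  - by case: (UV b cVb).
  have wb : @web_dom R m b.
    apply: contrapT => nwb; apply: (UV b cVb); apply: EfU; apply: FE.
    left; apply: (@boundary_web R m); split; last by move=> /interior_subset.
    by apply: closure_subset cb => w /V0V1[].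
  have V1b : V1 b by split=> //; exact: EtV.
  have oVb := @open_connected_component R V1 b oV1.
  have Vbb : connected_component V1 b b by exact: connected_component_refl.
  have [y [V0y Vby]] := cb _ (open_nbhs_nbhs (conj oVb Vbb)).
  apply: (connected_component_trans V0y); exact: connected_component_sym Vby.
have V0F : V0 `&` frame = set0.
  apply/seteqP; split=> // w [/V0V1[Vw _] /FE/EfU Uw].
  by have : (U `&` V) w by []; rewrite UV0.
have XF := iter_avoid_frame oV0 bV0 Vb V0F.
have [b cb nb] := bounded_open_not_closed oV0 bV0 (ex_intro _ z V0z).
apply: nb; apply: Vb => //; apply/escapingP => A.
have [k Ak] := side_unbounded A.
(* On [rect k] the modulus is at most [3 * side k], so from [N] on the orbit of [z] is outside
   [web_dom k]. The connected image of [V0] avoids its boundary, hence all of [web_dom k], and so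
   does the limit point [iter n f b]. *)
have [N hN] := (escapingP z).1 ez (3 * side k + 1).
exists N => n /hN zn; apply: le_trans Ak _; apply: normc_web_dom => bk.
have XG : (itf n @` V0) `&` @web_dom R k = set0.
  apply: connected_avoid_boundary; first exact: open_web_dom.
  - apply: connected_continuous_connected; first exact: component_connected.
    by apply: continuous_subspaceT; exact: continuous_iter.
  - apply/seteqP; split=> // w [Xw /boundary_web ww].
    have : ((itf n @` V0) `&` frame) w by split=> //; left.
    by rewrite XF.
  - move=> /(_ (iter n f z)) h.
    have /h/web_dom_rect[/andP[x1 x2] /andP[y1 y2]] : (itf n @` V0) (iter n f z) by exists z.
    have s8 := side_ge8 R k; have := normc_le_absD (iter n f z).
    have : `|Re (iter n f z)| <= 2 * side k by rewrite ler_norml; apply/andP; split; lra.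
    have : `|Im (iter n f z)| <= side k by rewrite ler_norml; apply/andP; split; lra.
    lra.
have nG : nbhs b (itf n @^-1` @web_dom R k).
  by apply: (@continuous_iter n b); apply: open_nbhs_nbhs; split=> //; exact: open_web_dom.
have [y [V0y wy]] := cb _ nG.
have : ((itf n @` V0) `&` @web_dom R k) (iter n f y) by split=> //; exists y.
by rewrite XG.
Qed.

End Connectedness.

Theorem theorem6p1 (R : realType) :
  contains_spiders_web (I_seq (@dyn_map R) (fun n => Num.sqrt 2 ^+ n)) /\
  spiders_web (escaping_set (@dyn_map R)).
Proof.
split.
  exists (@web R); first exact: web_I_seq.
  exact: spiders_web_of_web (@connected_web R).
apply: spiders_web_of_web; last exact: connected_escaping.
by move=> z /web_I_seq; exact: I_seq_escaping.
Qed.
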